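(* Suppose $(W,S)$ and $(W',S')$ are finite Coxeter systems and $c$ and $c'$ are Coxeter elements of $W$ and $W'$ respectively. Suppose $\eta:\mathrm{Camb}(W,c)\to\mathrm{Camb}(W',c')$ is a surjective lattice homomorphism and let $J=\{s\in S:\eta(s)\neq 1'\}$, where $1'$ is the identity of $W'$. Then $\eta$ factors as $\eta=\eta|_{\mathrm{Camb}(W_J,\tilde c)}\circ(\eta_J)|_{\mathrm{Camb}(W,c)}$, where $\tilde c$ is the restriction of $c$ to $W_J$ and $\eta_J:W\to W_J$ is the parabolic homomorphism. The map $\eta|_{\mathrm{Camb}(W_J,\tilde c)}$ is a compressive homomorphism.
   Context: For a finite Coxeter system $(W,S)$ with length function $\ell$, the (right) weak order on $W$ is the lattice with cover relations $w\lessdot ws$ for $w\in W$, $s\in S$, $\ell(w)<\ell(ws)$. A lattice homomorphism preserves pairwise meets and joins. Let $m(r,s)$ be the order of $rs$. A Coxeter element $c$ is a product of the elements of $S$, each used once, in some order; for $r,s\in S$ with $m(r,s)>2$, $r$ precedes $s$ in $c$ if $r$ comes before $s$ in every reduced word for $c$. Let $\mathrm{alt}_k(s,r)$ be the product $srs\cdots$ of $k$ alternating letters starting with $s$. The Cambrian congruence $\Theta_c$ is the finest lattice congruence on the weak order on $W$ with $s\equiv\mathrm{alt}_{m(r,s)-1}(s,r)$ for every pair $r,s\in S$ such that $r$ precedes $s$ in $c$. The Cambrian lattice $\mathrm{Camb}(W,c)$ is the subposet of the weak order induced by the minimum (bottom) elements of the $\Theta_c$-classes; it is a sublattice of the weak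 order, and its atoms are the elements of $S$. For $J\subseteq S$, $W_J$ is the standard parabolic subgroup generated by $J$, and the restriction of $c$ to $W_J$ is the Coxeter element $\tilde c$ of $W_J$ obtained by deleting the letters in $S\setminus J$ from a reduced word for $c$. Every $w\in W$ has a unique factorization $w=w_J\cdot{}^Jw$ maximizing $\ell(w_J)$ subject to $\ell(w_J)+\ell({}^Jw)=\ell(w)$ and $w_J\in W_J$; the parabolic homomorphism is $\eta_J:w\mapsto w_J$. A homomorphism of finite lattices is compressive if it is surjective and restricts to a bijection between the sets of atoms (elements covering the minimum). *)

(* Defs.v *)
From HB Require Import structures.
From mathcomp Require Import all_boot all_fingroup.

Set Implicit Arguments.
Unset Strict Implicit.
Unset Printing Implicit Defensive.

Local Open Scope group_scope.

(* Lattice notions for the subposet [L] of [T] ordered by [le].  Meets and joins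
   are relational, so a subposet needs no packaged lattice structure. *)
Section Lattices.

Variables (T : Type) (le : rel T) (L : T -> Prop).

Definition is_meet (x y z : T) : Prop :=
  [/\ L z, le z x, le z y & forall t, L t -> le t x -> le t y -> le t z].

Definition is_join (x y z : T) : Prop :=
  [/\ L z, le x z, le y z & forall t, L t -> le x t -> le y t -> le z t].

Definition is_minimum (b : T) : Prop := L b /\ (forall x, L x -> le b x).

Definition covers (x y : T) : Prop :=
  [/\ L x, L y, le x y, x <> y &
      forall z, L z -> le x z -> le z y -> z = x \/ z = y].

Definition is_atom (a : T) : Prop := exists2 b, is_minimum b & covers b a.

(* Only the values of [R] on [L] matter. *)
Definition lattice_congruence (R : rel T) : Prop :=
  [/\ forall x, L x -> R x x,
      forall x y, L x -> L y -> R x y -> R y x,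
      forall x y z, L x -> L y -> L z -> R x y -> R y z -> R x z,
      forall x x' y y' z z', L x -> L x' -> L y -> L y' ->
        R x x' -> R y y' -> is_meet x y z -> is_meet x' y' z' -> R z z' &
      forall x x' y y' z z', L x -> L x' -> L y -> L y' ->
        R x x' -> R y y' -> is_join x y z -> is_join x' y' z' -> R z z'].

End Lattices.

Section LatticeMorphisms.

Variables (T T' : Type) (le : rel T) (L : T -> Prop).
Variables (le' : rel T') (L' : T' -> Prop) (f : T -> T').

(* A map from [L] to [L'] is a function on [T] whose values off [L] are ignored. *)
Definition lattice_hom : Prop :=
  [/\ forall x, L x -> L' (f x),
      forall x y z, L x -> L y -> is_meet le L x y z ->
        is_meet le' L' (f x) (f y) (f z) &
      forall x y z, L x -> L y -> is_join le L x y z ->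
        is_join le' L' (f x) (f y) (f z)].

Definition surjective_on : Prop := forall y, L' y -> exists2 x, L x & f x = y.

Definition bijective_on_atoms : Prop :=
  [/\ forall a, is_atom le L a -> is_atom le' L' (f a),
      forall a b, is_atom le L a -> is_atom le L b -> f a = f b -> a = b &
      forall a', is_atom le' L' a' -> exists2 a, is_atom le L a & f a = a'].

Definition compressive : Prop :=
  [/\ lattice_hom, surjective_on & bijective_on_atoms].

End LatticeMorphisms.

Section Coxeter.

Variable gT : finGroupType.
Implicit Types (W S J : {set gT}) (u v : seq gT) (c r s w x y : gT).

Definition word_prod u : gT := \prod_(s <- u) s.

(* The congruence on words generated by (rs)^m(r,s) = 1, m(r,s) being the order
   of rs.  As m(s,s) = 1, each generator is its own inverse, so the monoid
   presented this way is the group presented by the same relations. *)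
Inductive coxeter_equiv S : seq gT -> seq gT -> Prop :=
| CoxRefl u : coxeter_equiv S u u
| CoxSym u v : coxeter_equiv S u v -> coxeter_equiv S v u
| CoxTrans u v t :
    coxeter_equiv S u v -> coxeter_equiv S v t -> coxeter_equiv S u t
| CoxRel u v r s : r \in S -> s \in S ->
    coxeter_equiv S (u ++ flatten (nseq #[r * s] [:: r; s]) ++ v) (u ++ v).

(* [W] may be a proper subgroup of the ambient type, so that standard parabolic
   subgroups fall under the same definitions. *)
Definition coxeter_system W S : Prop :=
  [/\ <<S>> = W,
      forall s, s \in S -> #[s] = 2 &
      forall u v, {subset u <= S} -> {subset v <= S} ->
        word_prod u = word_prod v -> coxeter_equiv S u v].

(* [S ^+ n] is the set of products of n elements of S; an element of <<S>> is
   such a product for some n < #|gT|, so the search bound is harmless there. *)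
Definition coxeter_length S w : nat :=
  find (fun n => w \in S ^+ n) (iota 0 #|gT|).

Definition reduced_word S w u : Prop :=
  [/\ {subset u <= S}, word_prod u = w & size u = coxeter_length S w].

Definition weak_cover S : rel gT := fun w x =>
  [exists s in S, (x == w * s) && (coxeter_length S w < coxeter_length S x)].

Definition weak_le S : rel gT := connect (weak_cover S).

Definition coxeter_element S c : Prop :=
  exists2 u, perm_eq u (enum S) & word_prod u = c.

Definition precedes S c r s : Prop :=
  [/\ r \in S, s \in S, 2 < #[r * s] &
      forall u, reduced_word S c u -> index r u < index s u].

Definition alt (k : nat) s r : gT := \prod_(i < k) (if odd i then r else s).

Definition cambrian_congruence W S c x y : Prop :=
  forall R : rel gT,
    lattice_congruence (weak_le S) (fun w => w \in W) R ->
    (forall r s, precedes S c r s -> R s (alt #[r * s].-1 s r)) ->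
    R x y.

Definition camb W S c x : Prop :=
  x \in W /\
  (forall y, y \in W -> cambrian_congruence W S c x y -> weak_le S x y).

Definition coxeter_restriction S c J (ct : gT) : Prop :=
  exists2 u, reduced_word S c u & ct = word_prod [seq s <- u | s \in J].

(* The map w |-> w_J; the length is that of (W, S), and 1 is a legitimate
   starting candidate for the maximization. *)
Definition parabolic_hom S J w : gT :=
  [arg max_(u > 1%g | (u \in <<J>>) &&
     (coxeter_length S u + coxeter_length S (u^-1 * w) == coxeter_length S w)%N)
   coxeter_length S u].

End Coxeter.

(* Main.v *)
Require Import Defs.
From mathcomp Require Import all_boot all_fingroup cyclic.

(* The parity of the number of times a reflection occurs among the inversions of
   a word depends only on the product of the word, because this holds for the
   Coxeter relations.  So each w has an inversion set N(w), with #|N(w)| equal to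
   the length, and the weak order is inclusion of inversion sets.  Write T and
   T_J for the reflections of W and W_J.  Then w_J is the element with inversion
   set N(w) :&: T_J, the fibre of eta_J over t has a maximum, with inversion set
   N(t) :|: (T :\: T_J), and eta_J is a lattice homomorphism.

   Pulling congruences of W_J back along eta_J, and restricting congruences of W
   to the interval W_J, shows that the Cambrian congruence of W_J is the
   restriction of that of W; together with the maxima of the fibres this gives
   eta_J (Camb(W, c)) = Camb(W_J, ct), contained in Camb(W, c).

   Finally Camb(W, c) is closed under joins and contains S, so the longest
   elements w_0 and w_0(J) are the joins of S and J in it.  As eta kills the
   elements of S outside J, eta w_0 = eta (w_0(J)), and x_J is the meet of x and
   w_0(J), whence eta x = eta x_J. *)

Set Implicit Arguments.
Unset Strict Implicit.
Unset Printing Implicit Defensive.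

Local Open Scope group_scope.

(** * Words in the generators and the parity of their inversions *)

Section Words.

Variable gT : finGroupType.
Implicit Types (S J : {set gT}) (u v : seq gT) (s t x y : gT).

Lemma word_prod_nil : word_prod [::] = 1 :> gT.
Proof. by rewrite /word_prod big_nil. Qed.

Lemma word_prod_cons s u : word_prod (s :: u) = s * word_prod u.
Proof. by rewrite /word_prod big_cons. Qed.

Lemma word_prod_cat u v : word_prod (u ++ v) = word_prod u * word_prod v.
Proof. by rewrite /word_prod big_cat. Qed.

Lemma subset_consP S s u : {subset s :: u <= S} <-> s \in S /\ {subset u <= S}.
Proof.
split=> [h | [Ss h] x]; last by rewrite inE => /predU1P[->|/h].
by split=> [|x ux]; apply: h; rewrite inE ?eqxx ?ux ?orbT.
Qed.

Lemma subset_catP S u v :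
  {subset u ++ v <= S} <-> {subset u <= S} /\ {subset v <= S}.
Proof.
split=> [h | [hu hv] x]; last by rewrite mem_cat => /orP[/hu|/hv].
by split=> x ux; apply: h; rewrite mem_cat ux ?orbT.
Qed.

Lemma word_prod_gen S u : {subset u <= S} -> word_prod u \in <<S>>.
Proof.
by move=> h; rewrite /word_prod big_seq group_prod // => s /h; apply: mem_gen.
Qed.

Lemma gen_wordP S x :
  reflect (exists2 u, {subset u <= S} & word_prod u = x) (x \in <<S>>).
Proof.
apply: (iffP idP) => [/gen_prodgP[n [f Sf ->]] | [u Su <-]]; last first.
  exact: word_prod_gen.
exists [seq f i | i <- enum 'I_n]; first by move=> y /mapP[i _ ->].
by rewrite /word_prod big_map enumT.
Qed.

Lemma gen_words S n x :
  x \in S ^+ n -> exists u, [/\ {subset u <= S}, word_prod u = x & size u = n].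
Proof.
elim: n x => [|n IHn] x; first by move/set1P=> ->; exists [::]; rewrite word_prod_nil.
rewrite expgS => /mulsgP[s y Ss /IHn[u [Su <- <-]] ->].
by exists (s :: u); rewrite word_prod_cons; split=> //; apply/subset_consP.
Qed.

Lemma word_prod_expg S u : {subset u <= S} -> word_prod u \in S ^+ size u.
Proof.
elim: u => [|s u IHu]; first by rewrite word_prod_nil inE.
by case/subset_consP=> Ss /IHu hu; rewrite word_prod_cons expgS mem_mulg.
Qed.

(* The left inversion p s p^-1 for each factorization p s q of the word. *)
Fixpoint inversions u : seq gT :=
  if u is s :: u' then s :: [seq t ^ s^-1 | t <- inversions u'] else [::].

Definition odd_inversion u t : bool := odd (count_mem t (inversions u)).

Lemma count_mem_conj t x u :
  count_mem t [seq y ^ x | y <- u] = count_mem (t ^ x^-1) u.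
Proof.
rewrite count_map; apply: eq_count => y /=.
by rewrite -(inj_eq (conjg_inj x^-1)) conjgK.
Qed.

Lemma inversions_cat u v :
  inversions (u ++ v) =
    inversions u ++ [seq t ^ (word_prod u)^-1 | t <- inversions v].
Proof.
elim: u => [|s u IHu] /=.
  by rewrite word_prod_nil invg1 -[LHS]map_id; apply: eq_map => t; rewrite conjg1.
rewrite IHu map_cat -map_comp word_prod_cons; congr (_ :: _ ++ _).
by apply: eq_map => t /=; rewrite invMg conjgM.
Qed.

Lemma size_inversions u : size (inversions u) = size u.
Proof. by elim: u => //= s u <-; rewrite size_map. Qed.

Lemma odd_inversion_cat u v t :
  odd_inversion (u ++ v) t = odd_inversion u t (+) odd_inversion v (t ^ word_prod u).
Proof.
by rewrite /odd_inversion inversions_cat count_cat oddD count_mem_conj invgK.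
Qed.

(** Prefixing [r; s] adds the inversions [r] and [r * s * r] and conjugates the others by
    [(r * s)^-1], which raises the exponent in [(r * s) ^+ i * r] by two. *)
Lemma alternating_inversions n x r s : r * r = 1 -> s * s = 1 ->
  count_mem x (inversions (flatten (nseq n [:: r; s]))) =
    \sum_(i < n.*2) (x == (r * s) ^+ i * r)%g.
Proof.
move=> rr ss; have rV: r^-1 = r by rewrite -[r^-1]mulg1 -rr mulKg.
have sV: s^-1 = s by rewrite -[s^-1]mulg1 -ss mulKg.
elim: n x => [|n IHn] x /=; first by rewrite big_ord0.
rewrite doubleS !big_ord_recl /= addnA -addnA; congr (_ + _).
  by rewrite expg0 mul1g eq_sym.
rewrite [in LHS]count_mem_conj invgK /= [in LHS]count_mem_conj invgK IHn.
congr (_ + _).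
by congr nat_of_bool; rewrite eq_sym conjgE invgK rV /bump /= expg1 !mulgA.
apply: eq_bigr => i _; rewrite -conjgM; congr nat_of_bool.
rewrite -[x ^ _ == _](inj_eq (conjg_inj (r * s)^-1)) conjgK conjgE invgK invMg rV sV.
by rewrite /bump !add1n expgS expgSr !mulgA.
Qed.

(** A relator has trivial product, and its inversions [(r * s) ^+ i * r] run twice through a period
    of length [#[r * s]], so each occurs an even number of times. *)
Lemma coxeter_equiv_odd S u v t : (forall s, s \in S -> #[s] = 2) ->
  coxeter_equiv S u v -> odd_inversion u t = odd_inversion v t.
Proof.
move=> S2 euv; elim: euv t => {u v} [//|u v _ IH t|u v w _ IH1 _ IH2 t|u v r s Sr Ss t].
- by rewrite IH.
- by rewrite IH1 IH2.
have invol x: x \in S -> x * x = 1.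
  by move=> Sx; apply/eqP; rewrite -[x * x]/(x ^+ 2) -(S2 _ Sx) expg_order.
have prod_rel n: word_prod (flatten (nseq n [:: r; s])) = (r * s) ^+ n.
  elim: n => [|n IHn]; first by rewrite word_prod_nil.
  by rewrite /= !word_prod_cons IHn expgS mulgA.
rewrite !odd_inversion_cat prod_rel expg_order conjg1; congr (_ (+) _).
rewrite -[RHS]addFb; congr (_ (+) _); apply/negbTE.
rewrite /odd_inversion alternating_inversions ?invol // -addnn.
rewrite big_split_ord /= oddD.
rewrite [X in _ (+) odd X](eq_bigr
  (fun i : 'I__ => nat_of_bool (t ^ word_prod u == (r * s) ^+ i * r)%g)).
  by rewrite addbb.
by move=> i _; rewrite expgD expg_order mul1g.
Qed.

End Words.

(** * Length and reduced words *)

Section Length.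

Variable gT : finGroupType.
Implicit Types (S J : {set gT}) (u v : seq gT) (s t x y : gT).

Lemma coxeter_length_word S u :
  {subset u <= S} -> coxeter_length S (word_prod u) <= size u.
Proof.
move=> Su; rewrite leqNgt; apply/negP=> lt_u.
have lt_u': size u < #|gT|.
  by rewrite (leq_trans lt_u) // (leq_trans (find_size _ _)) // size_iota.
have := before_find 0 lt_u; rewrite nth_iota // add0n.
by rewrite word_prod_expg.
Qed.

Lemma reduced_word_exists S x : x \in <<S>> -> exists u, reduced_word S x u.
Proof.
case/gen_wordP=> u0 Su0 u0x.
have exP: exists n, x \in S ^+ n by exists (size u0); rewrite -u0x word_prod_expg.
case: (ex_minnP exP) => n /gen_words[u [Su ux sz_u]] n_min.
(* The prefixes of a shortest word have distinct products, since otherwise the segment between two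
   equal ones could be cut out. There are [n.+1] of them, so the search in [coxeter_length] reaches
   [n]. *)
have n_lt: n < #|gT|.
  rewrite -sz_u -(size_iota 0 (size u).+1) -(size_map (fun i => word_prod (take i u))).
  rewrite cardT uniq_leq_size ?enumT // => [|y _]; last by rewrite -enumT mem_enum.
  rewrite map_inj_in_uniq ?iota_uniq // => i j; rewrite !mem_iota !ltnS /=.
  wlog lt_ij: i j / i < j => [IH|] le_i le_j eq_ij.
    by have [lt_ij|lt_ji|//] := ltngtP i j; [apply: IH | apply/esym/IH].
  have: n <= size (take i u ++ drop j u).
    apply: n_min; rewrite -ux -{1}(cat_take_drop j u) word_prod_cat -eq_ij.
    rewrite -word_prod_cat word_prod_expg // => y; rewrite mem_cat.
    by case/orP=> [/mem_take | /mem_drop]; apply: Su.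
  rewrite size_cat size_drop size_takel // -sz_u leqNgt => /negP[].
  by rewrite -[X in _ < X](subnKC le_j) ltn_add2r.
have hasn: has (fun n => x \in S ^+ n) (iota 0 #|gT|).
  by apply/hasP; exists n; rewrite ?mem_iota // -ux -sz_u word_prod_expg.
have := nth_find 0 hasn; rewrite nth_iota ?add0n; last first.
  by rewrite -{2}(size_iota 0 #|gT|) -has_find.
by case/gen_words=> v [Sv vx sz_v]; exists v.
Qed.

Lemma coxeter_length1 S : coxeter_length S 1 = 0.
Proof. by apply/eqP; rewrite -leqn0 -(word_prod_nil gT) (coxeter_length_word (u := [::])). Qed.

Lemma coxeter_length_eq0 S x : x \in <<S>> -> coxeter_length S x = 0 -> x = 1.
Proof.
move=> /reduced_word_exists[u [_ <- <-]] /size0nil->; exact: word_prod_nil.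
Qed.

Lemma reduced_cons S s u x : reduced_word S x (s :: u) ->
  [/\ s \in S, reduced_word S (word_prod u) u & x = s * word_prod u].
Proof.
case=> /subset_consP[Ss Su] <- /=; rewrite word_prod_cons => szu; split=> //; split=> //.
apply/eqP; rewrite eqn_leq coxeter_length_word // andbT.
have [v [Sv vu <-]] := reduced_word_exists (word_prod_gen Su).
rewrite -vu -word_prod_cons in szu; rewrite -ltnS szu.
by rewrite (coxeter_length_word (u := s :: v)) //; apply/subset_consP.
Qed.

End Length.

(** * Reflections and inversion sets *)

Section Reflections.

Variable gT : finGroupType.
Implicit Types (S J : {set gT}) (u v : seq gT) (s t x y : gT).

(** A consequence of the Coxeter presentation that passes at once to subsets of [S], so that
    parabolic subgroups are covered without a presentation of their own. *)
Definition inversions_coherent S : Prop :=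
  (forall s, s \in S -> #[s] = 2) /\
  (forall u v, {subset u <= S} -> {subset v <= S} ->
     word_prod u = word_prod v -> odd_inversion u =1 odd_inversion v).

Lemma coxeter_system_coherent W S : coxeter_system W S -> inversions_coherent S.
Proof.
case=> _ S2 Seq; split=> // u v Su Sv uv t.
exact: coxeter_equiv_odd S2 (Seq _ _ Su Sv uv).
Qed.

Lemma coherent_sub S J : J \subset S -> inversions_coherent S -> inversions_coherent J.
Proof.
move=> /subsetP sJS [S2 Sc]; split=> [s /sJS/S2 //| u v Ju Jv].
by apply: Sc => s /[dup]; [move/Ju/sJS | move/Jv/sJS].
Qed.

(** Fixing the word length makes the existential finite, hence boolean. Under coherence every word
    for [x] gives the same parity. *)
Definition inversion_set S x : {set gT} :=
  [set t | [exists u : (coxeter_length S x).-tuple gT,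
     [&& all (mem S) u, word_prod u == x & odd_inversion u t]]].

Definition reflections S : {set gT} := class_support S <<S>>.

Lemma reflectionP S t :
  reflect (exists s x, [/\ s \in S, x \in <<S>> & t = s ^ x]) (t \in reflections S).
Proof.
apply: (iffP imset2P) => [[s x Ss Wx ->] | [s [x [Ss Wx ->]]]]; first by exists s, x.
by exists s x.
Qed.

Lemma reflectionsJ S t x : x \in <<S>> -> (t ^ x \in reflections S) = (t \in reflections S).
Proof.
move=> Wx; apply: memJ_norm; apply/normP; exact: class_supportGidr Wx.
Qed.

Lemma reflections_gen S t : t \in reflections S -> t \in <<S>>.
Proof. by case/reflectionP=> s [x [Ss Wx ->]]; rewrite groupJ // mem_gen. Qed.

Lemma reflections_gens S s : s \in S -> s \in reflections S.
Proof. by move=> Ss; apply/reflectionP; exists s, 1; rewrite group1 conjg1. Qed.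

Lemma reflectionsS J S : J \subset S -> reflections J \subset reflections S.
Proof.
move=> sJS; apply/subsetP=> t /reflectionP[s [x [Js Jx ->]]].
apply/reflectionP; exists s, x; split=> //; first exact: (subsetP sJS).
exact: (subsetP (genS sJS)).
Qed.

Section Theory.

Variable S : {set gT}.
Hypothesis hS : inversions_coherent S.

Local Notation W := <<S>>.
Local Notation len := (coxeter_length S).
Local Notation N := (inversion_set S).
Local Notation T := (reflections S).

Lemma gens_invol s : s \in S -> s * s = 1.
Proof.
by move=> Ss; apply/eqP; rewrite -[s * s]/(s ^+ 2) -(hS.1 _ Ss) expg_order.
Qed.

Lemma gens_inv s : s \in S -> s^-1 = s.
Proof. by move=> Ss; rewrite -[s^-1]mulg1 -(gens_invol Ss) mulKg. Qed.

(** Exchange property: multiplying [p s q] on the left by [p s p^-1] cancels the letter [s]. *)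
Lemma inversions_delete u t : {subset u <= S} -> t \in inversions u ->
  exists2 v, [/\ {subset v <= u} & (size v).+1 = size u] & t * word_prod u = word_prod v.
Proof.
elim: u t => //= s u IHu t /subset_consP[Ss Su].
rewrite inE => /predU1P[->|/mapP[y /(IHu _ Su)[v [vu szv] eqv] ->]].
  exists u; last by rewrite word_prod_cons mulgA gens_invol ?mul1g.
  by split=> // x; rewrite inE => ->; rewrite orbT.
exists (s :: v).
  split; last by rewrite /= szv.
  by move=> x; rewrite !inE => /predU1P[->|/vu->]; rewrite ?eqxx ?orbT.
by rewrite !word_prod_cons -eqv conjgE invgK !mulgA mulgKV.
Qed.

Lemma inversion_set_word u t : {subset u <= S} ->
  (t \in N (word_prod u)) = odd_inversion u t.
Proof.
move=> Su; rewrite inE; apply/existsP/idP => [[v /and3P[/allP Sv /eqP vu]] | odd_u].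
  by rewrite (hS.2 _ _ Sv Su vu).
have [v [Sv vu /eqP szv]] := reduced_word_exists (word_prod_gen Su).
exists (Tuple szv); rewrite /= vu eqxx /= (hS.2 _ _ Sv Su vu) odd_u andbT.
exact/allP.
Qed.

Lemma inversion_set1 : N 1 = set0.
Proof.
by apply/setP=> t; rewrite -(word_prod_nil gT) inversion_set_word ?in_set0.
Qed.

Lemma inversion_set_gen s : s \in S -> N s = [set s].
Proof.
move=> Ss; apply/setP=> t; have -> : s = word_prod [:: s].
  by rewrite word_prod_cons word_prod_nil mulg1.
rewrite inversion_set_word => [|x]; last by rewrite inE => /eqP->.
by rewrite /odd_inversion /= addn0 word_prod_cons word_prod_nil mulg1 inE eq_sym oddb.
Qed.

(** The cocycle identity on which the later computations rest; it is concatenation of words, read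
    through parities. *)
Lemma inversion_setM x y t : x \in W -> y \in W ->
  (t \in N (x * y)) = (t \in N x) (+) (t ^ x \in N y).
Proof.
case/gen_wordP=> u Su <- /gen_wordP[v Sv <-].
rewrite -word_prod_cat !inversion_set_word ?odd_inversion_cat //.
exact/subset_catP.
Qed.

Lemma inversion_word u t : {subset u <= S} -> t \in N (word_prod u) -> t \in inversions u.
Proof.
move=> Su; rewrite inversion_set_word // /odd_inversion -has_pred1 has_count.
by case: (count _ _).
Qed.

Lemma inversions_reflection u t : {subset u <= S} -> t \in inversions u -> t \in T.
Proof.
elim: u t => //= s u IHu t /subset_consP[Ss Su].
rewrite inE => /predU1P[->|/mapP[y /(IHu _ Su) Ty ->]]; first exact: reflections_gens.
by rewrite reflectionsJ // groupV mem_gen.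
Qed.

Lemma inversion_reflection x : x \in W -> N x \subset T.
Proof.
case/gen_wordP=> u Su <-; apply/subsetP=> t /(inversion_word Su).
exact: inversions_reflection.
Qed.

Lemma length_inversion x t : x \in W -> t \in N x -> len (t * x) < len x.
Proof.
case/reduced_word_exists=> u [Su <- szu] /(inversion_word Su)/(inversions_delete Su)[v [vu szv] ->].
rewrite -szu -szv ltnS coxeter_length_word // => y /vu; exact: Su.
Qed.

(** If the first inversion recurred, deleting both letters concerned would leave the product
    unchanged, giving a word two letters shorter. *)
Lemma reduced_uniq x u : reduced_word S x u -> uniq (inversions u).
Proof.
elim: u x => //= s u IHu x /[dup] red_su /reduced_cons[Ss red_u x_su].
rewrite (map_inj_uniq (conjg_inj _)) (IHu _ red_u) andbT; apply/mapP=> [[t ut s_t]].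
have ts : t = s by rewrite -(conjgKV s t) -s_t conjgE mulKg.
have [v [vu szv] eqv] := inversions_delete (fun y uy => let: And3 Su _ _ := red_u in Su y uy) ut.
case: red_su => _ _ szu; have: len x <= size v.
  rewrite x_su -ts eqv coxeter_length_word // => y /vu; case: red_u => Su _ _; exact: Su.
by rewrite -szu /= -szv ltnNge leqnSn.
Qed.

Lemma inversions_reduced x u : reduced_word S x u -> N x =i inversions u.
Proof.
move=> red_u t; have [Su ux _] := red_u.
rewrite -ux inversion_set_word // /odd_inversion count_uniq_mem ?oddb //.
exact: reduced_uniq red_u.
Qed.

Lemma card_inversion_set x : x \in W -> #|N x| = len x.
Proof.
case/reduced_word_exists=> u red_u; rewrite (eq_card (inversions_reduced red_u)).
rewrite (card_uniqP (reduced_uniq red_u)) size_inversions.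
by case: red_u.
Qed.

Lemma inversion_setV x t : x \in W -> (t \in N x^-1) = (t ^ x^-1 \in N x).
Proof.
move=> Wx; have := inversion_setM (t ^ x^-1) Wx (groupVr Wx).
by rewrite mulgV inversion_set1 inE conjgKV; case: (t \in _); case: (_ \in _).
Qed.

(** In the product [x^-1 * s * x] the contributions of [x^-1] and [x] at this reflection cancel, and
    the middle letter contributes once. *)
Lemma reflection_self t : t \in T -> t \in N t.
Proof.
case/reflectionP=> s [x [Ss Wx ->]]; have Ws := mem_gen Ss; have WVx := groupVr Wx.
rewrite {2}conjgE inversion_setM ?groupM // inversion_setV // inversion_setM //.
rewrite conjgK (inversion_set_gen Ss) set11 [s ^ s]conjgE mulKg.
by case: (s \in N x).
Qed.

Lemma reflection_invol t : t \in T -> t * t = 1.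
Proof. by case/reflectionP=> s [y [Ss Wy ->]]; rewrite -conjMg gens_invol ?conj1g. Qed.

(** If [t] is not an inversion of [x], the cocycle identity makes it one of [t * x], and multiplying
    by [t] again shortens [t * x] to [x]. *)
Lemma length_reflection x t : x \in W -> t \in T -> (t \in N x) = (len (t * x) < len x).
Proof.
move=> Wx Tt; apply/idP/idP=> [|lt_tx]; first exact: length_inversion.
have Wt := reflections_gen Tt.
apply: contraLR lt_tx => tNx; rewrite -leqNgt ltnW //.
rewrite -{1}[x]mul1g -(reflection_invol Tt) -mulgA length_inversion ?groupM //.
by rewrite inversion_setM // reflection_self // conjgE mulKg (negPf tNx).
Qed.

End Theory.

End Reflections.

(** * The weak order as inclusion of inversion sets *)

Section WeakOrder.

Variable gT : finGroupType.
Implicit Types (S J : {set gT}) (u v : seq gT) (s t x y : gT).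

Section Theory.

Variable S : {set gT}.
Hypothesis hS : inversions_coherent S.

Local Notation W := <<S>>.
Local Notation len := (coxeter_length S).
Local Notation N := (inversion_set S).
Local Notation T := (reflections S).

Lemma inversion_setVM x y t : x \in W -> y \in W ->
  (t \in N (x^-1 * y)) = (t ^ x^-1 \in N x) (+) (t ^ x^-1 \in N y).
Proof. by move=> Wx Wy; rewrite inversion_setM ?groupV // inversion_setV. Qed.

Lemma inversion_set_eq1 x : x \in W -> N x = set0 -> x = 1.
Proof.
move=> Wx N0; apply: (coxeter_length_eq0 Wx).
by rewrite -(card_inversion_set hS) // N0 cards0.
Qed.

Lemma inversion_set_inj : {in W &, injective N}.
Proof.
move=> x y Wx Wy eqN; apply: (mulgI x^-1); rewrite mulVg; apply/esym.
apply: inversion_set_eq1; first by rewrite groupM ?groupV.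
by apply/setP=> t; rewrite inversion_setVM // eqN addbb in_set0.
Qed.

(** By the cocycle identity [N (x^-1 * y)] is conjugate to the symmetric difference of [N x] and
    [N y], so lengths add exactly when [N x :\: N y] is empty. *)
Lemma length_addE x y : x \in W -> y \in W ->
  (len x + len (x^-1 * y) == len y)%N = (N x \subset N y).
Proof.
move=> Wx Wy; rewrite -!(card_inversion_set hS) ?groupM ?groupV //.
have -> : #|N (x^-1 * y)| = (#|N x :\: N y| + #|N y :\: N x|)%N.
  have disj: (N x :\: N y) :&: (N y :\: N x) = set0.
    by apply/setP=> t; rewrite in_setI !in_setD in_set0; case: (t \in N x); rewrite ?andbF.
  rewrite -(cardJg _ x^-1) -cardsUI disj cards0 addn0.
  apply: eq_card => t; rewrite mem_conjg invgK inversion_setVM // conjgK.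
  by rewrite in_setU !in_setD; case: (t \in N x); case: (t \in N y).
rewrite -(cardsID (N y) (N x)) -[X in _ == X](cardsID (N x) (N y)) setIC.
rewrite -addnA eqn_add2l addnA -[X in _ == X]add0n eqn_add2r addn_eq0 andbb.
by rewrite cards_eq0 setD_eq0.
Qed.

Lemma reduced_head_inversion s u x : reduced_word S x (s :: u) -> s \in N x.
Proof. by move=> red_su; rewrite (inversions_reduced hS red_su) /= inE eqxx. Qed.

Lemma inversion_set_mulg x s : x \in W -> s \in S -> len x <= len (x * s) ->
  N (x * s) = s ^ x^-1 |: N x.
Proof.
move=> Wx Ss le_x; have Ws := mem_gen Ss.
have xs_notin: s ^ x^-1 \notin N x.
  rewrite (length_reflection hS) ?reflectionsJ ?groupV ?reflections_gens //.
  by rewrite conjgE invgK mulgA mulgKV -leqNgt.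
apply/setP=> t; rewrite inversion_setM // (inversion_set_gen hS Ss) in_setU !in_set1.
rewrite -[t ^ x == s](inj_eq (conjg_inj x^-1)) conjgK.
have [-> | _] := eqVneq; last by rewrite addbF.
by rewrite (negPf xs_notin).
Qed.

Lemma weak_cover_sub x y : x \in W -> weak_cover S x y ->
  y \in W /\ N x \subset N y.
Proof.
move=> Wx /existsP[s /and3P[Ss /eqP-> /ltnW le_x]].
split; last by rewrite inversion_set_mulg ?subsetUr.
have Ws := mem_gen Ss; exact: groupM.
Qed.

(** For the converse, follow a reduced word of [x^-1 * y]. If [s] is its first letter, [s ^ x^-1]
    lies in exactly one of [N x] and [N y]; the inclusion makes it [N y], so [x * s] covers [x] and
    its inversions still lie in [N y]. *)
Lemma weak_leE x y : x \in W -> weak_le S x y = (y \in W) && (N x \subset N y).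
Proof.
move=> Wx; apply/idP/andP=> [/connectP[p] | [Wy]].
  elim: p x Wx => [x Wx _ -> // | z p IHp x Wx /= /andP[xz zp] eq_y].
  have [Wz sub_xz] := weak_cover_sub Wx xz.
  by have [-> /(subset_trans sub_xz)] := IHp z Wz zp eq_y.
have [u] := reduced_word_exists (groupM (groupVr Wx) Wy).
elim: u x Wx => [|s u IHu] x Wx red_u sub_xy.
  case: red_u => _ eq_xy _; suff ->: y = x by exact: connect0.
  by apply: (mulgI x^-1); rewrite -eq_xy word_prod_nil mulVg.
have [Ss red_u' eq_su] := reduced_cons red_u; have Ws := mem_gen Ss.
have := reduced_head_inversion red_u; rewrite inversion_setVM //.
case s_x: (s ^ x^-1 \in N x); first by rewrite (subsetP sub_xy _ s_x).
move=> /= s_y; have lt_x: len x < len (x * s).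
  rewrite ltnNge -!(card_inversion_set hS) ?groupM //.
  have -> : N (x * s) = s ^ x^-1 |: N x.
    apply/setP=> t; rewrite inversion_setM // (inversion_set_gen hS Ss) in_setU !in_set1.
    rewrite -[t ^ x == s](inj_eq (conjg_inj x^-1)) conjgK.
    by have [-> | _] := eqVneq; rewrite ?s_x // addbF.
  by rewrite cardsU1 s_x ltnn.
apply: (@connect_trans _ _ (x * s)).
  by apply/connect1/existsP; exists s; rewrite Ss eqxx.
apply: IHu; rewrite ?groupM //.
  by rewrite invMg (gens_inv hS Ss) -mulgA eq_su mulgA (gens_invol hS) // mul1g.
rewrite inversion_set_mulg ?(ltnW lt_x) // subUset sub_xy andbT sub1set.
exact: s_y.
Qed.

Lemma weak_le_anti x y : x \in W -> weak_le S x y -> weak_le S y x -> x = y.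
Proof.
move=> Wx; rewrite weak_leE // => /andP[Wy xy]; rewrite weak_leE // => /andP[_ yx].
by apply: inversion_set_inj => //; apply/eqP; rewrite eqEsubset xy.
Qed.

Lemma weak_le_gen x y : x \in W -> weak_le S x y -> y \in W.
Proof. by move=> Wx; rewrite weak_leE // => /andP[]. Qed.

Lemma weak_le1 x : x \in W -> weak_le S 1 x.
Proof. move=> Wx; rewrite weak_leE ?group1 // Wx (inversion_set1 hS). exact: sub0set. Qed.

Definition longest : gT := [arg max_(x > 1%g | x \in W) len x].

(** A reflection [t] that is not an inversion of [w] would make [t * w] longer than [w]. *)
Lemma longestP : longest \in W /\ N longest = T.
Proof.
rewrite /longest; case: arg_maxnP => [|w Ww w_max]; first exact: group1.
split=> //; apply/eqP; rewrite eqEsubset (inversion_reflection hS) //=.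
apply/subsetP=> t Tt; apply: contraLR Tt => tNw; apply/negP=> Tt.
have Wt := reflections_gen Tt; have /w_max := groupM Wt Ww.
have t_in : t \in N (t * w).
  by rewrite inversion_setM // (reflection_self hS) // conjgE mulKg (negPf tNw).
have := length_inversion hS (groupM Wt Ww) t_in.
by rewrite mulgA (reflection_invol hS Tt) mul1g ltnNge => /negP.
Qed.

Lemma longest_gen : longest \in W. Proof. by case: longestP. Qed.

Lemma longest_max x : x \in W -> weak_le S x longest.
Proof.
move=> Wx; have [W0 N0] := longestP.
by rewrite weak_leE // W0 N0 (inversion_reflection hS).
Qed.

(* [z * longest] has the complementary inversion set, hence no left descent. *)
Lemma inversions_gens_longest z : z \in W -> S \subset N z -> z = longest.
Proof.
move=> Wz sub_S; have [W0 N0] := longestP; apply: inversion_set_inj => //; rewrite N0.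
have Nz0 t : (t \in N (z * longest)) = (t \in N z) (+) (t \in T).
  by rewrite inversion_setM // N0 reflectionsJ.
suff z0_1 : z * longest = 1.
  apply/setP=> t; have := Nz0 t; rewrite z0_1 inversion_set1 // in_set0.
  by case: (t \in N z); case: (t \in T).
have [[|s u] red_u] := reduced_word_exists (groupM Wz W0).
  by case: red_u; rewrite word_prod_nil.
have [Ss _ _] := reduced_cons red_u.
have := reduced_head_inversion red_u; rewrite Nz0 (subsetP sub_S) //.
by rewrite reflections_gens.
Qed.

End Theory.

(** * Standard parabolic subgroups and the projection onto them *)

Section Parabolic.

Variables (S J : {set gT}).
Hypothesis (hS : inversions_coherent S) (sJS : J \subset S).

Local Notation W := <<S>>.
Local Notation WJ := <<J>>.
Local Notation len := (coxeter_length S).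
Local Notation N := (inversion_set S).
Local Notation T := (reflections S).
Local Notation TJ := (reflections J).
Local Notation hJ := (coherent_sub sJS hS).

Lemma parabolic_gen x : x \in WJ -> x \in W.
Proof. exact: subsetP (genS sJS) x. Qed.

Lemma inversion_set_parabolic x : x \in WJ -> inversion_set J x = N x.
Proof.
case/gen_wordP=> u Ju <-; apply/setP=> t.
rewrite (inversion_set_word hJ) // (inversion_set_word hS) // => y /Ju.
exact: (subsetP sJS).
Qed.

Lemma inversion_parabolic_sub x : x \in WJ -> N x \subset TJ.
Proof.
by move=> Jx; rewrite -inversion_set_parabolic //; apply: inversion_reflection hJ _ Jx.
Qed.

Lemma length_parabolic x : x \in WJ -> coxeter_length J x = len x.
Proof.
move=> Jx; rewrite -(card_inversion_set hJ) // inversion_set_parabolic //.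
by rewrite (card_inversion_set hS) // parabolic_gen.
Qed.

Lemma weak_le_parabolic x y : x \in WJ -> y \in WJ -> weak_le J x y = weak_le S x y.
Proof.
move=> Jx Jy; rewrite (weak_leE hJ) // (weak_leE hS) ?parabolic_gen // Jy.
by rewrite !inversion_set_parabolic.
Qed.

Lemma parabolic_gens s : s \in S -> (s \in WJ) = (s \in J).
Proof.
move=> Ss; apply/idP/idP=> [Js | ]; last exact: mem_gen.
have [u [Ju us szu]] := reduced_word_exists Js.
move: szu; rewrite length_parabolic // -(card_inversion_set hS) ?mem_gen //.
rewrite (inversion_set_gen hS) // cards1; case: u us Ju => [|s' []] //= <- + _.
by rewrite word_prod_cons word_prod_nil mulg1; apply; rewrite inE.
Qed.

(** Write [w = x * v] with [v] shortest in the coset [WJ :* w]. Left multiplication by a reflection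
    of [WJ] stays in the coset, so [v] has no inversion in [TJ], and the cocycle identity leaves
    only those of [x]. *)
Lemma parabolic_decomposition w : w \in W -> exists2 x, x \in WJ & N x = N w :&: TJ.
Proof.
move=> Ww; have w_in: w \in WJ :* w by rewrite rcoset_refl.
have [v v_in v_min] := arg_minnP len w_in.
have [x Jx eq_w] : exists2 x, x \in WJ & w = x * v.
  by exists (w * v^-1); [rewrite -mem_rcoset rcoset_sym | rewrite mulgKV].
have Wx := parabolic_gen Jx; have Wv: v \in W by rewrite -(groupMl _ Wx) -eq_w.
exists x => //; apply/setP=> t; rewrite in_setI eq_w inversion_setM //.
case TJt: (t \in TJ); last first.
  by rewrite andbF; apply: contraFF TJt; apply/subsetP/inversion_parabolic_sub.
suff /negPf->: t ^ x \notin N v by rewrite addbF andbT.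
have TJtx: t ^ x \in TJ by rewrite reflectionsJ.
have tv_in: t ^ x * v \in WJ :* w.
  rewrite mem_rcoset eq_w invMg !mulgA mulgK; apply: groupM; last exact: groupVr.
  exact: reflections_gen.
rewrite (length_reflection hS) ?(subsetP (reflectionsS sJS)) // -leqNgt.
exact: (v_min _ tv_in).
Qed.

(** The maximization runs over the [u] in [WJ] with [N u \subset N w]. The element of
    [parabolic_decomposition] is a candidate whose inversion set contains all the others, so the two
    agree by cardinality. *)
Lemma parabolic_homP w : w \in W ->
  parabolic_hom S J w \in WJ /\ N (parabolic_hom S J w) = N w :&: TJ.
Proof.
move=> Ww; rewrite /parabolic_hom; case: arg_maxnP => [|u /andP[Ju]].
  by rewrite group1 coxeter_length1 invg1 mul1g eqxx.
have Wu := parabolic_gen Ju; rewrite length_addE // => sub_u u_max; split=> //.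
have [x Jx Nx] := parabolic_decomposition Ww; have Wx := parabolic_gen Jx.
have/u_max: (x \in WJ) && (len x + len (x^-1 * w) == len w)%N.
  by rewrite Jx length_addE // Nx subsetIl.
rewrite -!(card_inversion_set hS) // -Nx => le_x; apply/eqP; rewrite eqEcard.
by apply/andP; split=> //; rewrite Nx subsetI sub_u inversion_parabolic_sub.
Qed.

Lemma parabolic_hom_gen w : w \in W -> parabolic_hom S J w \in WJ.
Proof. by case/parabolic_homP. Qed.

Lemma inversion_set_hom w : w \in W -> N (parabolic_hom S J w) = N w :&: TJ.
Proof. by case/parabolic_homP. Qed.

Lemma parabolicE x : x \in W -> (x \in WJ) = (N x \subset TJ).
Proof.
move=> Wx; apply/idP/idP=> [|sub_x]; first exact: inversion_parabolic_sub.
have [y Jy] := parabolic_decomposition Wx; rewrite (setIidPl sub_x) => /inversion_set_inj.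
by move=> <- //; rewrite parabolic_gen.
Qed.

Lemma parabolic_hom_id x : x \in WJ -> parabolic_hom S J x = x.
Proof.
move=> Jx; have Wx := parabolic_gen Jx; have [J' N'] := parabolic_homP Wx.
apply: (inversion_set_inj hS) => //; first exact: parabolic_gen.
by rewrite N'; apply/setIidPl/inversion_parabolic_sub.
Qed.

Lemma parabolic_hom_le x : x \in W -> weak_le S (parabolic_hom S J x) x.
Proof.
move=> Wx; have [J' N'] := parabolic_homP Wx.
by rewrite (weak_leE hS) ?(parabolic_gen J') // Wx N' subsetIl.
Qed.

Lemma parabolic_hom_mono x y : x \in W -> weak_le S x y ->
  weak_le S (parabolic_hom S J x) (parabolic_hom S J y).
Proof.
move=> Wx; rewrite (weak_leE hS) // => /andP[Wy xy].
have [Jx Nx] := parabolic_homP Wx; have [Jy Ny] := parabolic_homP Wy.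
by rewrite (weak_leE hS) ?(parabolic_gen Jx) // (parabolic_gen Jy) Nx Ny setSI.
Qed.

Lemma parabolic_lower x y : x \in W -> y \in WJ -> weak_le S x y -> x \in WJ.
Proof.
move=> Wx Jy; rewrite (weak_leE hS) // => /andP[Wy xy]; rewrite parabolicE //.
exact: subset_trans xy (inversion_parabolic_sub Jy).
Qed.

(* The maximum of the fibre of [parabolic_hom S J] over [t] is [t * fibre_top]. *)
Definition fibre_top : gT := longest J * longest S.

(** The cocycle identity gives the symmetric difference of [N t], [TJ] and [T], because [TJ] and [T]
    are stable under the conjugations involved; and [N t] lies in [TJ], which lies in [T]. *)
Lemma fibre_topP t : t \in WJ ->
  t * fibre_top \in W /\ N (t * fibre_top) = N t :|: (T :\: TJ).
Proof.
move=> Jt; have Wt := parabolic_gen Jt.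
have [J0 N0] := longestP hJ; have [W0 NS0] := longestP hS.
rewrite inversion_set_parabolic // in N0; have WJ0 := parabolic_gen J0.
split; first by rewrite !groupM.
apply/setP=> r; rewrite inversion_setM ?groupM // inversion_setM //.
rewrite NS0 N0 !reflectionsJ // in_setU in_setD.
have := subsetP (inversion_parabolic_sub Jt) r.
have := subsetP (reflectionsS sJS) r.
by case: (r \in N t); case: (r \in TJ); case: (r \in T) => //= h h';
  first [have := h isT | have := h' isT].
Qed.

End Parabolic.

End WeakOrder.

(** * Existence of joins and meets in the weak order *)

Section WeakLattice.

Variables (gT : finGroupType) (S : {set gT}).
Hypothesis hS : inversions_coherent S.
Implicit Types (u v : seq gT) (s t x y : gT).

Local Notation W := <<S>>.
Local Notation len := (coxeter_length S).
Local Notation N := (inversion_set S).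
Local Notation T := (reflections S).
Local Notation le := (weak_le S).
Local Notation meetW := (is_meet le (fun w => w \in W)).
Local Notation joinW := (is_join le (fun w => w \in W)).

Lemma weak_le_trans : transitive le. Proof. exact: connect_trans. Qed.
Lemma weak_le_refl x : le x x. Proof. exact: connect0. Qed.

Lemma weak_cover_le z q : z \in W -> weak_cover S z q -> [/\ q \in W, le z q & len z < len q].
Proof.
move=> Wz zq; have [Wq _] := weak_cover_sub hS Wz zq; split=> //; first exact: connect1.
by case/existsP: zq => s /and3P[_ /eqP->].
Qed.

Lemma weak_le_first x y : le x y -> x = y \/ exists2 q, weak_cover S x q & le q y.
Proof.
case/connectP=> [[|q p] /=]; first by left.
case/andP=> xq qp ->; right; exists q => //; apply/connectP; exists p => //.
Qed.

(** The join is [z * longest [set s; t]]. If [u] lies above [z * s] and [z * t], then [s] and [t]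
    are inversions of [z^-1 * u], so the parabolic component of [z^-1 * u] is the longest one, and
    all its inversions, carried back by [z], lie in [N u]. *)
Lemma weak_cover_join z q r : z \in W -> weak_cover S z q -> weak_cover S z r ->
  exists j, joinW q r j.
Proof.
move=> Wz /existsP[s /and3P[Ss /eqP-> lt_s]] /existsP[t /and3P[St /eqP-> lt_t]].
have Ws := mem_gen Ss; have Wt := mem_gen St.
have Ns := inversion_set_mulg hS Wz Ss (ltnW lt_s).
have Nt := inversion_set_mulg hS Wz St (ltnW lt_t).
have Wzs := groupM Wz Ws; have Wzt := groupM Wz Wt.
have not_in a : a \in S -> len z < len (z * a) -> a ^ z^-1 \notin N z.
  move=> Sa lt_a; rewrite (length_reflection hS) ?reflectionsJ ?groupV ?reflections_gens //.
  by rewrite conjgE invgK mulgA mulgKV -leqNgt ltnW.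
pose K := [set s; t]; have sKS: K \subset S by rewrite subUset !sub1set Ss St.
have hK := coherent_sub sKS hS; have [K0 N0] := longestP hK.
have W0 := parabolic_gen sKS K0; rewrite (inversion_set_parabolic hS sKS) // in N0.
have upper (u a : gT) : u \in W -> N (z * s) \subset N u -> N (z * t) \subset N u ->
    a ^ z \in reflections K -> a \notin N z /\ a \in N u.
  move=> Wu; rewrite Ns Nt !subUset !sub1set => /andP[us sub_u] /andP[ut _] Ka.
  have Wv := groupM (groupVr Wz) Wu.
  have [vK vN] := parabolic_homP hS sKS Wv.
  have v_max: parabolic_hom S K (z^-1 * u) = longest K.
    apply: inversions_gens_longest => //.
    rewrite (inversion_set_parabolic hS sKS) // vN subsetI; apply/andP; split; last first.
      by apply/subsetP=> b; exact: reflections_gens.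
    rewrite subUset !sub1set !inversion_setVM // us ut.
    by rewrite (negPf (not_in s _ _)) ?(negPf (not_in t _ _)).
  have : a ^ z \in N (z^-1 * u).
    by have := Ka; rewrite -N0 -v_max vN in_setI => /andP[].
  rewrite inversion_setVM // conjgK; have := subsetP sub_u a.
  by case: (a \in N z); case: (a \in N u) => // /(_ isT).
have Nj: N (z * longest K) = N z :|: [set a | a ^ z \in reflections K].
  apply/setP=> a; rewrite inversion_setM // N0 in_setU [X in _ || X]inE.
  case Ka: (a ^ z \in _); last by rewrite addbF orbF.
  have [WS NS] := longestP hS.
  have subS w : w \in W -> N w \subset N (longest S) by rewrite NS; exact: inversion_reflection.
  by have [/negPf-> _] := upper _ a WS (subS _ Wzs) (subS _ Wzt) Ka.
have Wj := groupM Wz W0.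
have sub_j a : a \in K -> a ^ z^-1 \in [set b | b ^ z \in reflections K].
  by move=> Ka; rewrite inE conjgKV reflections_gens.
exists (z * longest K); split=> //.
- rewrite weak_leE // Wj Ns Nj setUC setUS // sub1set; apply: sub_j.
  by rewrite !inE eqxx.
- rewrite weak_leE // Wj Nt Nj setUC setUS // sub1set; apply: sub_j.
  by rewrite !inE eqxx orbT.
move=> u Wu; rewrite !weak_leE // => /andP[_ su] /andP[_ tu]; rewrite Wu Nj subUset /=.
apply/andP; split; first by apply: subset_trans su; rewrite Ns subsetUr.
by apply/subsetP=> a; rewrite inE => /(upper _ _ Wu su tu)[].
Qed.

(* Joins above [z] are glued from joins above two elements covering [z]
   (Bjorner-Edelman-Ziegler), by descending induction on [z]. *)
Lemma weak_join_exists x y : x \in W -> y \in W -> exists z, joinW x y z.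
Proof.
move=> Wx Wy.
suff joins n z : z \in W -> len (longest S) < n + len z ->
    forall x y, le z x -> le z y -> exists w, joinW x y w.
  apply: (joins (len (longest S)).+1 1); rewrite ?group1 ?weak_le1 //.
  by rewrite ltnS leq_addr.
elim: n z {x y Wx Wy} => [|n IHn] z Wz lt_n x y zx zy.
  have [W0 N0] := longestP hS; move: lt_n.
  rewrite add0n -!(card_inversion_set hS) // N0 ltnNge subset_leq_card //.
  exact: inversion_reflection.
have Wx := weak_le_gen hS Wz zx; have Wy := weak_le_gen hS Wz zy.
have [<-|[q zq qx]] := weak_le_first zx; first by exists y; split=> //; apply: weak_le_refl.
have [<-|[r zr ry]] := weak_le_first zy; first by exists x; split=> //; apply: weak_le_refl.
have [j [Wj qj rj j_min]] := weak_cover_join Wz zq zr.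
have [Wq _ lt_q] := weak_cover_le Wz zq; have [Wr _ lt_r] := weak_cover_le Wz zr.
have lt_nq: len (longest S) < n + len q by rewrite (leq_trans lt_n) // addSnnS leq_add2l.
have lt_nr: len (longest S) < n + len r by rewrite (leq_trans lt_n) // addSnnS leq_add2l.
(* Above [q], join [x] with [j]; the result lies above [r], where it can be joined with [y]. *)
have [a [Wa xa ja a_min]] := IHn q Wq lt_nq x j qx qj.
have [b [Wb ab yb b_min]] := IHn r Wr lt_nr a y (weak_le_trans rj ja) ry.
exists b; split=> //; first exact: weak_le_trans xa ab.
move=> u Wu xu yu; apply: b_min => //; apply: a_min => //; apply: j_min => //.
  exact: weak_le_trans qx xu.
exact: weak_le_trans ry yu.
Qed.

(** Take a longest common lower bound: its join with any other common lower bound is again one,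
    hence no longer, hence equal to it. *)
Lemma weak_meet_exists x y : x \in W -> y \in W -> exists z, meetW x y z.
Proof.
move=> Wx Wy; pose P := [pred z in W | le z x && le z y].
have P1: P 1 by rewrite inE group1 !weak_le1.
case: (@arg_maxnP _ 1 P len P1) => z /and3P[Wz zx zy] z_max.
exists z; split=> // t Wt tx ty.
have [w [Ww zw tw w_min]] := weak_join_exists Wz Wt.
have le_wz: len w <= len z by apply: z_max; rewrite inE Ww !w_min.
suff -> : z = w by [].
apply: (inversion_set_inj hS) => //; apply/eqP.
by rewrite eqEcard !(card_inversion_set hS) // le_wz andbT; move: zw; rewrite weak_leE // Ww.
Qed.

Lemma meet_le x y : x \in W -> le x y -> meetW x y x.
Proof. by move=> Wx xy; split=> //; apply: weak_le_refl. Qed.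

End WeakLattice.

(** * The parabolic projection as a lattice homomorphism, and transport of congruences *)

Section ParabolicLattice.

Variables (gT : finGroupType) (S J : {set gT}).
Hypothesis (hS : inversions_coherent S) (sJS : J \subset S).
Implicit Types (u v : seq gT) (s t x y : gT).

Local Notation W := <<S>>.
Local Notation WJ := <<J>>.
Local Notation N := (inversion_set S).
Local Notation eta := (parabolic_hom S J).
Local Notation meetW := (is_meet (weak_le S) (fun w => w \in W)).
Local Notation joinW := (is_join (weak_le S) (fun w => w \in W)).
Local Notation meetJ := (is_meet (weak_le J) (fun w => w \in WJ)).
Local Notation joinJ := (is_join (weak_le J) (fun w => w \in WJ)).

(** Makes [t * fibre_top S J] the value at [t] of an upper adjoint of [eta], which is why [eta]
    preserves joins; dually, the inclusion of [WJ] is a lower adjoint. *)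
Lemma eta_adjoint x t : x \in W -> t \in WJ ->
  weak_le S (eta x) t -> weak_le S x (t * fibre_top S J).
Proof.
move=> Wx Jt; have [Wtp Ntp] := fibre_topP hS sJS Jt.
rewrite !weak_leE ?(parabolic_gen sJS (parabolic_hom_gen hS sJS Wx)) // Wtp.
rewrite Ntp inversion_set_hom // => /andP[_ sub_t]; apply/subsetP=> a xa.
rewrite in_setU in_setD (subsetP (inversion_reflection hS Wx)) // andbT orbC -implybE.
by apply/implyP=> Ja; rewrite (subsetP sub_t) // in_setI xa.
Qed.

Lemma eta_fibre_top t : t \in WJ -> eta (t * fibre_top S J) = t.
Proof.
move=> Jt; have [Wtp Ntp] := fibre_topP hS sJS Jt.
apply: (inversion_set_inj hS); rewrite ?(parabolic_gen sJS) ?parabolic_hom_gen //.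
have disj: (reflections S :\: reflections J) :&: reflections J = set0.
  by apply/setP=> a; rewrite in_setI in_setD in_set0; case: (a \in reflections J); rewrite ?andbF.
rewrite inversion_set_hom // Ntp setIUl disj setU0.
exact/setIidPl/inversion_parabolic_sub.
Qed.

Lemma eta_meet x y z : x \in W -> y \in W -> meetW x y z -> meetJ (eta x) (eta y) (eta z).
Proof.
move=> Wx Wy [Wz zx zy z_max]; have etaJ w: w \in W -> eta w \in WJ by exact: parabolic_hom_gen.
split; rewrite ?(weak_le_parabolic hS sJS) ?etaJ ?parabolic_hom_mono // => t Jt.
rewrite !(weak_le_parabolic hS sJS) ?etaJ // => tx ty.
rewrite -(parabolic_hom_id hS sJS Jt) parabolic_hom_mono ?(parabolic_gen sJS) //.
have Wt := parabolic_gen sJS Jt.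
apply: z_max => //; first exact: weak_le_trans tx (parabolic_hom_le hS sJS Wx).
exact: weak_le_trans ty (parabolic_hom_le hS sJS Wy).
Qed.

Lemma eta_join x y z : x \in W -> y \in W -> joinW x y z -> joinJ (eta x) (eta y) (eta z).
Proof.
move=> Wx Wy [Wz xz yz z_min]; have etaJ w: w \in W -> eta w \in WJ by exact: parabolic_hom_gen.
split; rewrite ?(weak_le_parabolic hS sJS) ?etaJ ?parabolic_hom_mono // => t Jt.
rewrite !(weak_le_parabolic hS sJS) ?etaJ // => tx ty.
rewrite -(eta_fibre_top Jt) parabolic_hom_mono //; have [Wtp _] := fibre_topP hS sJS Jt.
by apply: z_min => //; apply: eta_adjoint.
Qed.

Lemma parabolic_meet x y z : x \in WJ -> y \in WJ -> meetJ x y z -> meetW x y z.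
Proof.
move=> Jx Jy [Jz zx zy z_max]; rewrite !(weak_le_parabolic hS sJS) // in zx zy.
split=> //; first exact: (parabolic_gen sJS).
move=> t Wt tx ty; have Jt := parabolic_lower hS sJS Wt Jx tx.
by rewrite -(weak_le_parabolic hS sJS) // z_max ?(weak_le_parabolic hS sJS).
Qed.

(** An upper bound [t] in [W] may be replaced by the smaller [eta t], which lies in [WJ] and still
    bounds [x] and [y]. *)
Lemma parabolic_join x y z : x \in WJ -> y \in WJ -> joinJ x y z -> joinW x y z.
Proof.
move=> Jx Jy [Jz xz yz z_min]; rewrite !(weak_le_parabolic hS sJS) // in xz yz.
split=> //; first exact: (parabolic_gen sJS).
move=> t Wt xt yt; have Jt := parabolic_hom_gen hS sJS Wt.
apply: weak_le_trans (parabolic_hom_le hS sJS Wt).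
rewrite -(weak_le_parabolic hS sJS) // z_min ?(weak_le_parabolic hS sJS) //.
  by rewrite -(parabolic_hom_id hS sJS Jx) parabolic_hom_mono ?(parabolic_gen sJS).
by rewrite -(parabolic_hom_id hS sJS Jy) parabolic_hom_mono ?(parabolic_gen sJS).
Qed.

Lemma pullback_congruence (R : rel gT) :
  lattice_congruence (weak_le J) (fun w => w \in WJ) R ->
  lattice_congruence (weak_le S) (fun w => w \in W) (fun x y => R (eta x) (eta y)).
Proof.
have etaJ w: w \in W -> eta w \in WJ by exact: parabolic_hom_gen.
case=> Rr Rs Rt Rm Rj; split=> [x Wx|x y Wx Wy|x y z Wx Wy Wz||].
- exact/Rr/etaJ.
- by apply: Rs; apply: etaJ.
- by apply: Rt; apply: etaJ.
- move=> x x' y y' z z' Wx Wx' Wy Wy' Rx Ry.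
  move=> /eta_meet-/(_ Wx Wy) mz /eta_meet-/(_ Wx' Wy') mz'.
  by apply: Rm Rx Ry mz mz'; apply: etaJ.
move=> x x' y y' z z' Wx Wx' Wy Wy' Rx Ry.
move=> /eta_join-/(_ Wx Wy) mz /eta_join-/(_ Wx' Wy') mz'.
by apply: Rj Rx Ry mz mz'; apply: etaJ.
Qed.

Lemma restrict_congruence (R : rel gT) :
  lattice_congruence (weak_le S) (fun w => w \in W) R ->
  lattice_congruence (weak_le J) (fun w => w \in WJ) R.
Proof.
have JW w: w \in WJ -> w \in W by exact: parabolic_gen.
case=> Rr Rs Rt Rm Rj; split=> [x Jx|x y Jx Jy|x y z Jx Jy Jz||].
- exact/Rr/JW.
- by apply: Rs; apply: JW.
- by apply: Rt; apply: JW.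
- move=> x x' y y' z z' Jx Jx' Jy Jy' Rx Ry.
  move=> /parabolic_meet-/(_ Jx Jy) mz /parabolic_meet-/(_ Jx' Jy') mz'.
  by apply: Rm Rx Ry mz mz'; apply: JW.
move=> x x' y y' z z' Jx Jx' Jy Jy' Rx Ry.
move=> /parabolic_join-/(_ Jx Jy) mz /parabolic_join-/(_ Jx' Jy') mz'.
by apply: Rj Rx Ry mz mz'; apply: JW.
Qed.

End ParabolicLattice.

(** Pulled back along a parabolic homomorphism, equality becomes its kernel congruence, which
    [camb_gens] compares with the Cambrian congruence. *)
Lemma eq_congruence (gT : finGroupType) (S : {set gT}) : inversions_coherent S ->
  lattice_congruence (weak_le S) (fun w => w \in <<S>>) eq_op.
Proof.
move=> hS; split=> [x _|x y _ _|x y z _ _ _|x x' y y' z z'|x x' y y' z z'] //.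
- by rewrite eq_sym.
- by move=> /eqP->.
- move=> _ _ _ _ /eqP-> /eqP-> [Wz zx zy z_max] [Wz' zx' zy' z_max'].
  by apply/eqP/(weak_le_anti hS Wz); [apply: z_max' | apply: z_max].
move=> _ _ _ _ /eqP-> /eqP-> [Wz zx zy z_min] [Wz' zx' zy' z_min'].
by apply/eqP/(weak_le_anti hS Wz); [apply: z_min | apply: z_min'].
Qed.

Lemma index_filter (T : eqType) (p : pred T) (w : seq T) (x y : T) : p x -> p y ->
  (index x [seq z <- w | p z] < index y [seq z <- w | p z])%N = (index x w < index y w)%N.
Proof.
move=> px py; elim: w => //= z w IHw; case pz: (p z) => /=.
  by case: eqP => _; case: eqP => _ //; rewrite ltnS IHw.
have [eq_zx|_] := eqVneq z x; first by rewrite -eq_zx pz in px.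
by have [eq_zy|_] := eqVneq z y; [rewrite -eq_zy pz in py | rewrite ltnS IHw].
Qed.

(** * Words without repeated letters and reduced words of Coxeter elements *)

Section CoxeterWords.

Variables (gT : finGroupType) (S : {set gT}).
Hypothesis hS : inversions_coherent S.
Implicit Types (I J K : {set gT}) (u v : seq gT) (a b r s t x y : gT).

Local Notation W := <<S>>.
Local Notation N := (inversion_set S).

Lemma parabolic_inversion_gen K x s : K \subset S -> x \in <<K>> -> s \in S ->
  s \in N x -> s \in K.
Proof.
move=> sKS Kx Ss /(subsetP (inversion_parabolic_sub hS sKS Kx))/reflections_gen.
by rewrite (parabolic_gens hS sKS).
Qed.

(** The first letter of a reduced word is an inversion of [x], so it belongs to both [I] and [J];
    strip it and repeat. *)
Lemma parabolic_capI I J x : I \subset S -> J \subset S ->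
  x \in <<I>> -> x \in <<J>> -> x \in <<I :&: J>>.
Proof.
move=> sIS sJS Ix Jx; have Wx := parabolic_gen sIS Ix.
have [u] := reduced_word_exists Wx.
elim: u x Ix Jx {Wx} => [|s u IHu] x Ix Jx red_u.
  by case: red_u; rewrite word_prod_nil => _ <- _; apply: group1.
have [Ss red_u' eq_x] := reduced_cons red_u.
have sNx := reduced_head_inversion hS red_u.
have Is := parabolic_inversion_gen sIS Ix Ss sNx.
have Js := parabolic_inversion_gen sJS Jx Ss sNx.
rewrite eq_x; apply: groupM; first by rewrite mem_gen // in_setI Is.
apply: IHu => //.
  by move: Ix; rewrite eq_x (groupMl _ (mem_gen Is)).
by move: Jx; rewrite eq_x (groupMl _ (mem_gen Js)).
Qed.

Lemma word_parabolic u : {subset u <= S} -> [set x in u] \subset S.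
Proof. by move=> Su; apply/subsetP=> x; rewrite inE => /Su. Qed.

Lemma word_prod_parabolic u : word_prod u \in <<[set x in u]>>.
Proof. by apply: word_prod_gen => x; rewrite inE. Qed.

Lemma word_inversion_gen u s : {subset u <= S} -> s \in S ->
  s \in N (word_prod u) -> s \in u.
Proof.
move=> Su Ss /(parabolic_inversion_gen (word_parabolic Su) (word_prod_parabolic u) Ss).
by rewrite inE.
Qed.

Lemma uniq_head_inversion s u : {subset s :: u <= S} -> s \notin u ->
  s \in N (word_prod (s :: u)).
Proof.
case/subset_consP=> Ss Su s_u; have Ws := mem_gen Ss.
rewrite word_prod_cons inversion_setM ?word_prod_gen // (inversion_set_gen hS Ss) set11.
by rewrite conjgE mulKg; apply: contra s_u; apply: word_inversion_gen.
Qed.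

(** If [a] and [b] did not commute, [a] would be an inversion of [a * b * a], an element of [<<K>>],
    forcing [a] into [K]. *)
Lemma commute_parabolic K a b : K \subset S -> a \in S -> a \notin K -> b \in K ->
  b ^ a \in <<K>> -> commute a b.
Proof.
move=> sKS Sa Ka Kb Kab; have Sb := subsetP sKS _ Kb.
have Wa := mem_gen Sa; have Wb := mem_gen Sb.
apply/eqP; apply: contraR Ka => ncomm.
apply: (parabolic_inversion_gen sKS Kab Sa).
rewrite conjgE (gens_inv hS Sa) inversion_setM ?groupM //.
rewrite inversion_setM // !(inversion_set_gen hS) // !in_set1 eqxx.
rewrite conjgE mulKg; have neq_ab: a != b by apply: contraNneq ncomm => ->.
rewrite (negPf neq_ab) /= conjgE; apply: contra ncomm => /eqP eq_ab.
by rewrite -{2}eq_ab mulKVg.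
Qed.

(** The first letter [b] is an inversion of the product [q] and of [q * a = a * q]. Hence [b ^ a] is
    an inversion of [q] and lies in the parabolic subgroup of the letters, so [commute_parabolic]
    applies; then cancel [b]. *)
Lemma commute_uniq_word a v : a \in S -> {subset v <= S} -> uniq v -> a \notin v ->
  commute a (word_prod v) -> forall b, b \in v -> commute a b.
Proof.
move=> Sa; have Wa := mem_gen Sa.
elim: v => // b v IHv Sbv /= /andP[bv uniq_v]; rewrite inE negb_or => /andP[ab av] comm.
have [Sb Sv] := (subset_consP S b v).1 Sbv; have Wb := mem_gen Sb.
have Wq := word_prod_gen Sbv; have Nb := uniq_head_inversion Sbv bv.
have comm_ab: commute a b.
  apply: (commute_parabolic (word_parabolic Sbv)); rewrite ?inE ?eqxx ?negb_or ?ab //.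
  have: b \in N (word_prod (b :: v) * a).
    rewrite inversion_setM // Nb (inversion_set_gen hS Sa) in_set1.
    apply: contra ab => /eqP eq_a; apply/eqP/(mulIg (word_prod (b :: v))).
    by rewrite comm -eq_a conjgE mulKVg.
  rewrite -comm inversion_setM // (inversion_set_gen hS Sa) in_set1 eq_sym (negPf ab) /=.
  move/(subsetP (inversion_parabolic_sub hS (word_parabolic Sbv) (word_prod_parabolic _))).
  exact: reflections_gen.
move=> c; rewrite inE => /predU1P[-> // | cv]; apply: IHv => //.
apply: (mulgI b); rewrite mulgA -comm_ab -!mulgA -word_prod_cons.
by rewrite comm word_prod_cons mulgA.
Qed.

Lemma inversions_split v t : t \in inversions v ->
  exists v1 b v2, v = v1 ++ b :: v2 /\ t = b ^ (word_prod v1)^-1.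
Proof.
elim: v t => //= b v IHv t; rewrite inE => /predU1P[->|/mapP[y]].
  by exists [::], b, v; rewrite word_prod_nil invg1 conjg1.
case/IHv=> v1 [b' [v2 [-> ->]]] ->; exists (b :: v1), b', v2; split=> //.
by rewrite word_prod_cons invMg conjgM.
Qed.

(** As an inversion of the common product, [a] is conjugate by a prefix [v1] to the next letter [b]
    of [v]. So [b] lies in the parabolic subgroup of [a :: v1], and since [b] does not occur in
    [v1], it is [a]. *)
Lemma uniq_words_head a u v : {subset a :: u <= S} -> {subset v <= S} ->
  a \notin u -> uniq v -> word_prod (a :: u) = word_prod v ->
  exists v1 v2, v = v1 ++ a :: v2 /\ commute a (word_prod v1).
Proof.
move=> Sau Sv au uniq_v eq_uv; have [Sa Su] := (subset_consP S a u).1 Sau.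
have := uniq_head_inversion Sau au; rewrite eq_uv => /(inversion_word hS Sv).
case/inversions_split=> v1 [b [v2 [eq_v eq_a]]].
have Sv' := Sv; rewrite eq_v in Sv'.
have [Sv1 /subset_consP[Sb _]] := (subset_catP S v1 (b :: v2)).1 Sv'.
have eq_b: b = a ^ word_prod v1 by rewrite eq_a conjgKV.
have bv1: b \notin v1.
  by move: uniq_v; rewrite eq_v cat_uniq /= negb_or => /and3P[_ /andP[]].
have ba: b = a.
  have sub: [set x in a :: v1] \subset S.
    by apply/word_parabolic/subset_consP.
  have: b \in <<[set x in a :: v1]>>.
    rewrite eq_b groupJ //; first by rewrite mem_gen // !inE eqxx.
    by apply: word_prod_gen => x xv; rewrite inE in_cons xv orbT.
  by rewrite (parabolic_gens hS sub) // inE in_cons (negPf bv1) orbF => /eqP.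
exists v1, v2; rewrite -{1}ba; split=> //.
by rewrite /commute -{1}(mulKVg (word_prod v1) (a * _)) -conjgE -eq_b ba.
Qed.

(* Words without repetition that have the same product differ by commutations,
   so they agree on the relative order of two noncommuting letters. *)
Lemma uniq_words_filter u v r s : {subset u <= S} -> {subset v <= S} ->
  uniq u -> uniq v -> word_prod u = word_prod v -> ~ commute r s ->
  [seq x <- u | x \in [:: r; s]] = [seq x <- v | x \in [:: r; s]].
Proof.
move=> Su Sv uniq_u uniq_v eq_uv ncomm.
elim: u v Su Sv uniq_u uniq_v eq_uv => [|a u IHu] v Su Sv.
  case: v Sv => // b v Sv _ /= /andP[bv _] eq_uv.
  by have := uniq_head_inversion Sv bv; rewrite -eq_uv word_prod_nil inversion_set1 // in_set0.
rewrite [uniq _]/= => /andP[au uniq_u] uniq_v eq_uv.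
have [v1 [v2 [eq_v comm]]] := uniq_words_head Su Sv au uniq_v eq_uv.
have [Sa Su'] := (subset_consP S a u).1 Su.
rewrite {}eq_v in Sv uniq_v eq_uv *.
have [Sv1 /subset_consP[_ Sv2]] := (subset_catP S v1 (a :: v2)).1 Sv.
have uniq_av: uniq (a :: v1 ++ v2) by rewrite -cat1s uniq_catCA.
move: uniq_av; rewrite /= mem_cat negb_or -andbA => /and3P[av1 av2 uniq_v12].
have uniq_v1: uniq v1 by move: uniq_v12; rewrite cat_uniq => /and3P[].
have comm_v1 := commute_uniq_word Sa Sv1 uniq_v1 av1 comm.
have -> : [seq x <- u | x \in [:: r; s]] = [seq x <- v1 ++ v2 | x \in [:: r; s]].
  apply: IHu => //; first exact/subset_catP.
  apply: (mulgI a); rewrite -word_prod_cons eq_uv !word_prod_cat word_prod_cons.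
  by rewrite !mulgA comm.
rewrite !filter_cat /=; case: ifP => // a_rs.
suff -> : [seq x <- v1 | x \in [:: r; s]] = [::] by [].
apply/eqP; rewrite -(negbK (_ == _)) -has_filter; apply/hasP=> [[x xv1]].
have neq_xa: x != a by apply: contraNneq av1 => <-.
move: a_rs neq_xa; rewrite !inE => /orP[]/eqP eq_a /negPf neq_xa /orP[]/eqP eq_x;
  have := comm_v1 x xv1; rewrite ?eq_a ?eq_x //; rewrite eq_a eq_x ?eqxx // in neq_xa.
by move=> /esym.
Qed.

(** A word for [c] omitting [s] would put [c], and then [s] itself, in the subgroup generated by
    [S :\ s]. So every generator occurs, and the length leaves room for one occurrence each. *)
Lemma coxeter_reduced_word c u : coxeter_element S c -> reduced_word S c u ->
  uniq u /\ u =i S.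
Proof.
case=> u0 perm_u0 prod_u0 [Su prod_u szu].
have Su0: {subset u0 <= S} by move=> x; rewrite (perm_mem perm_u0) mem_enum.
have uniq_u0: uniq u0 by rewrite (perm_uniq perm_u0) enum_uniq.
have sub_u: {subset u0 <= u}.
  move=> s s_u0; apply: contraT => s_u; have Ss := Su0 s s_u0.
  pose K := S :\ s; have sKS: K \subset S by exact: subsetDl.
  have: s \in <<K>>.
    have [u1 [u2 [eq_u0 [su1 su2]]]]: exists u1 u2,
        u0 = u1 ++ s :: u2 /\ (s \notin u1 /\ s \notin u2).
      case/splitPr: s_u0 uniq_u0 => u1 u2; rewrite cat_uniq /= negb_or.
      by case/and3P=> _ /andP[su1 _] /andP[su2 _]; exists u1, u2.
    have Ku w : {subset w <= S} -> s \notin w -> word_prod w \in <<K>>.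
      move=> Sw sw; apply: word_prod_gen => x xw; rewrite !inE (Sw x xw) andbT.
      by apply: contraNneq sw => <-.
    have Su0' := Su0; rewrite eq_u0 in Su0'.
    have [Su1 /subset_consP[_ Su2]] := (subset_catP S u1 (s :: u2)).1 Su0'.
    have := Ku u Su s_u; rewrite prod_u -prod_u0 eq_u0 word_prod_cat word_prod_cons.
    by rewrite groupMl ?groupMr ?Ku.
  by rewrite (parabolic_gens hS sKS) // !inE eqxx.
have sz_le: size u <= size u0 by rewrite szu -prod_u0 coxeter_length_word.
split; first exact: leq_size_uniq uniq_u0 sub_u sz_le.
by move=> x; apply/idP/idP=> [/Su //| Sx]; rewrite sub_u // (perm_mem perm_u0) mem_enum.
Qed.

(** One reduced word decides precedence: commuting involutions have a product of order at most two,
    so here [r] and [s] do not commute, and [uniq_words_filter] fixes their order. *)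
Lemma precedesP c u r s : coxeter_element S c -> reduced_word S c u ->
  precedes S c r s <->
    [/\ r \in S, s \in S, (2 < #[r * s])%N & (index r u < index s u)%N].
Proof.
move=> hc red_u; split=> [[Sr Ss rs2 /(_ _ red_u)] // | [Sr Ss rs2 lt_u]].
split=> // v red_v.
have [uniq_u _] := coxeter_reduced_word hc red_u.
have [uniq_v _] := coxeter_reduced_word hc red_v.
have [Su eq_u _] := red_u; have [Sv eq_v _] := red_v.
have ncomm: ~ commute r s.
  move=> comm; have: #[r * s] %| 2.
    by rewrite order_dvdn expgMn // -(hS.1 r Sr) expg_order mul1g hS.1 // -(hS.1 s Ss) expg_order.
  by move/(dvdn_leq (isT : 0 < 2)); rewrite leqNgt rs2.
have := uniq_words_filter Su Sv uniq_u uniq_v (etrans eq_u (esym eq_v)) ncomm.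
have rr: r \in [:: r; s] by rewrite inE eqxx.
have ss: s \in [:: r; s] by rewrite !inE eqxx orbT.
by rewrite -(index_filter v rr ss) => <-; rewrite index_filter.
Qed.

End CoxeterWords.

(** * Restricted Coxeter elements and the generators of the Cambrian congruence *)

Section Cambrian.

Variables (gT : finGroupType) (S : {set gT}).
Hypothesis hS : inversions_coherent S.
Implicit Types (J K : {set gT}) (u v : seq gT) (c r s t x y : gT).

Local Notation W := <<S>>.
Local Notation N := (inversion_set S).

Lemma restriction_precedes J c ct : J \subset S -> coxeter_element S c ->
  coxeter_restriction S c J ct ->
  forall r s, precedes J ct r s <-> [/\ precedes S c r s, r \in J & s \in J].
Proof.
move=> sJS hc [u red_u eq_ct] r s; have hJ := coherent_sub sJS hS.
have [uniq_u eq_u] := coxeter_reduced_word hS hc red_u.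
pose v := [seq x <- u | x \in J].
have uniq_v: uniq v by rewrite filter_uniq.
have eq_v: v =i J.
  move=> x; rewrite mem_filter eq_u andb_idr //; exact: (subsetP sJS).
have hct: coxeter_element J ct.
  by exists v => //; apply: uniq_perm => // [|x]; rewrite ?enum_uniq // mem_enum.
have red_v: reduced_word J ct v.
  split=> // [x|]; first by rewrite eq_v.
  (* Any reduced word of the Coxeter element [ct] is a permutation of [J], as is [v], so [v] has
     minimal length. *)
  have [w red_w] : exists w, reduced_word J ct w.
    by apply: reduced_word_exists; rewrite eq_ct word_prod_gen // => x; rewrite eq_v.
  have [uniq_w eq_w] := coxeter_reduced_word hJ hct red_w.
  case: red_w => _ _ <-; apply: perm_size; apply: uniq_perm => // x.
  by rewrite eq_w eq_v.
have [fromS toS] := precedesP hS r s hc red_u.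
have [fromJ toJ] := precedesP hJ r s hct red_v.
split=> [/fromJ[Jr Js rs2] | [/fromS[Sr Ss rs2 lt_u] Jr Js]].
  rewrite index_filter // => lt_u; split=> //.
  by apply: toS; split=> //; exact: (subsetP sJS).
by apply: toJ; split=> //; rewrite index_filter.
Qed.

Lemma altS k s r : alt k.+1 s r = s * alt k r s.
Proof.
by rewrite /alt big_ord_recl /=; congr (_ * _); apply: eq_bigr => i _; case: odd.
Qed.

Lemma alt_gen k s r : alt k s r \in <<[set s; r]>>.
Proof.
elim: k s r => [|k IHk] s r; first by rewrite /alt big_ord0 group1.
by rewrite altS groupM ?(mem_gen (set21 _ _)) // setUC.
Qed.

Lemma alt_inversion k s r t : s \in S -> r \in S ->
  (t \in N (alt k s r)) = odd (\sum_(i < k) (t == (s * r) ^+ i * s)%g).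
Proof.
elim: k s r t => [|k IHk] s r t Ss Sr.
  by rewrite /alt !big_ord0 inversion_set1 // in_set0.
have Ws := mem_gen Ss; have Wr := mem_gen Sr.
have Walt: alt k r s \in W.
  by apply: subsetP (alt_gen k r s); rewrite genS // subUset !sub1set Sr.
rewrite altS inversion_setM // (inversion_set_gen hS Ss) in_set1 IHk //.
rewrite big_ord_recl /= expg0 mul1g oddD oddb; congr (_ (+) odd _).
apply: eq_bigr => i _; congr nat_of_bool.
rewrite -[t ^ s == _](inj_eq (conjg_inj s^-1)) conjgK conjgE invgK (gens_inv hS Ss).
rewrite /bump add1n; congr (t == _); rewrite expgS !mulgA; congr (_ * s).
elim: (i : nat) => [|n IHn]; first by rewrite !expg0 !mulg1.
by rewrite !expgS -IHn !mulgA.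
Qed.

(** Among the inversions [(s * r) ^+ i * s], the letter [s] appears only when [#[r * s]] divides
    [i], hence only for [i = 0]. *)
Lemma alt_inversion_first k s r : s \in S -> r \in S -> (k < #[r * s])%N ->
  s \in N (alt k.+1 s r).
Proof.
move=> Ss Sr lt_k; rewrite alt_inversion // big_ord_recl /= expg0 mul1g eqxx.
rewrite big1 // => i _; apply/eqP; rewrite eqb0 -{1}[s]mul1g (inj_eq (mulIg s)).
rewrite eq_sym -order_dvdn -orderV invMg !(gens_inv hS) //.
by rewrite /bump add1n gtnNdvd // (leq_ltn_trans (ltn_ord i)).
Qed.

(** An equality [(s * r) ^+ i * s = r] would make [#[r * s]] divide [i.+1], which is at most [k]. *)
Lemma alt_inversion_last k s r : s \in S -> r \in S -> (k < #[r * s])%N ->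
  r \notin N (alt k s r).
Proof.
move=> Ss Sr lt_k; rewrite alt_inversion // big1 // => i _; apply/eqP.
rewrite eqb0 -(inj_eq (mulIg r)) (gens_invol hS Sr) -mulgA -expgSr.
rewrite eq_sym -order_dvdn -orderV invMg !(gens_inv hS) //.
by rewrite gtnNdvd // (leq_ltn_trans (ltn_ord i)).
Qed.

Lemma gen_set1 a x : a \in S -> x \in <<[set a]>> -> x = 1 \/ x = a.
Proof.
by move=> Sa; rewrite -/<[a]> cycle2g ?hS.1 // !inE => /orP[]/eqP; [left | right].
Qed.

(* Unless both letters lie in [J], the projection to [<<J>>] identifies the
   generators of the Cambrian congruence. *)
Lemma parabolic_hom_alt J r s : J \subset S -> r \in S -> s \in S ->
  (2 < #[r * s])%N -> ~~ ((r \in J) && (s \in J)) ->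
  parabolic_hom S J (alt #[r * s].-1 s r) = parabolic_hom S J s.
Proof.
move=> sJS Sr Ss rs2 notJ.
have rs_pos: (0 < #[r * s])%N := order_gt0 _.
set x := alt _ s r; pose I := [set s; r].
have sIS: I \subset S by rewrite subUset !sub1set Ss.
have Ix: x \in <<I>> := alt_gen _ _ _; have Wx := parabolic_gen sIS Ix.
have [Jy Ny] := parabolic_homP hS sJS Wx; set y := parabolic_hom S J x in Jy Ny *.
have Wy := parabolic_gen sJS Jy.
have Iy: y \in <<I>>.
  exact: (parabolic_lower hS sIS Wy Ix (parabolic_hom_le hS sJS Wx)).
have IJy := parabolic_capI hS sIS sJS Iy Jy.
have sx: s \in N x.
  rewrite /x -(ltn_predK (_ : 1 < #[r * s].-1)%N) ?alt_inversion_first //.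
    by rewrite (leq_ltn_trans (leq_pred _)) // prednK.
  by rewrite -ltnS prednK.
have rx: r \notin N x by rewrite alt_inversion_last // prednK.
(* Since [I :&: J] has at most one element, [y] is trivial or that generator; [sx] and [rx] decide
   which. *)
have sub1 a : I :&: J \subset [set a] -> a \in S -> y = 1 \/ y = a.
  by move=> sub Sa; apply: gen_set1 => //; apply: subsetP (genS sub) _ IJy.
have Ts: s \in J -> s \in N y.
  by move=> Js; rewrite Ny in_setI sx reflections_gens.
have Nr: r \notin N y by rewrite Ny in_setI (negPf rx).
case Js: (s \in J).
  rewrite (parabolic_hom_id hS sJS (mem_gen Js)).
  have [|y1|//] := sub1 s _ Ss.
    apply/subsetP=> a; rewrite !inE => /andP[/orP[//|/eqP->] Jr].
    by rewrite Jr Js in notJ.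
  by have := Ts Js; rewrite y1 inversion_set1 // in_set0.
have -> : parabolic_hom S J s = 1.
  have Ws := mem_gen Ss; apply: (inversion_set_eq1 hS).
    exact: (parabolic_gen sJS (parabolic_hom_gen hS sJS Ws)).
  rewrite inversion_set_hom // (inversion_set_gen hS Ss); apply/setP=> a.
  rewrite in_setI in_set1 in_set0; apply/andP=> [[/eqP-> /reflections_gen]].
  by rewrite (parabolic_gens hS sJS) // Js.
have [|//|yr] := sub1 r _ Sr.
  by apply/subsetP=> a; rewrite !inE => /andP[/orP[/eqP->|//]]; rewrite Js.
by have := Nr; rewrite yr (inversion_set_gen hS Sr) set11.
Qed.

(** * Bottom elements of the Cambrian classes: joins, atoms and the longest element *)

Section Camb.

Variable c : gT.

Local Notation le := (weak_le S).
Local Notation meetW := (is_meet le (fun w => w \in W)).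
Local Notation joinW := (is_join le (fun w => w \in W)).
Local Notation Theta := (cambrian_congruence W S c).
Local Notation Camb := (camb W S c).

Lemma cambrian_refl x : x \in W -> Theta x x.
Proof. by move=> Wx R [Rr _ _ _ _] _; apply: Rr. Qed.

Lemma cambrian_meet x x' y y' z z' : x \in W -> x' \in W -> y \in W -> y' \in W ->
  Theta x x' -> Theta y y' -> meetW x y z -> meetW x' y' z' -> Theta z z'.
Proof.
move=> Wx Wx' Wy Wy' xx' yy' mz mz' R cR gR; case: (cR) => _ _ _ Rm _.
by apply: Rm (xx' R cR gR) (yy' R cR gR) mz mz'.
Qed.

Lemma cambrian_join x x' y y' z z' : x \in W -> x' \in W -> y \in W -> y' \in W ->
  Theta x x' -> Theta y y' -> joinW x y z -> joinW x' y' z' -> Theta z z'.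
Proof.
move=> Wx Wx' Wy Wy' xx' yy' jz jz' R cR gR; case: (cR) => _ _ _ _ Rj.
by apply: Rj (xx' R cR gR) (yy' R cR gR) jz jz'.
Qed.

Lemma camb_gen x : Camb x -> x \in W. Proof. by case. Qed.

Lemma camb1 : Camb 1.
Proof. by split=> [|y Wy _]; [apply: group1 | apply: weak_le1]. Qed.

(** If [t] is congruent to [z], meeting with [x] shows that [x] is congruent to its meet with [t].
    Minimality of [x] puts it below [t]; the same holds for [y], hence for [z]. *)
Lemma camb_join x y z : Camb x -> Camb y -> joinW x y z -> Camb z.
Proof.
case=> Wx x_min [Wy y_min] [Wz xz yz z_min]; split=> // t Wt zt.
have below w : w \in W -> (forall v : gT, v \in W -> Theta w v -> le w v) -> le w z -> le w t.
  move=> Ww w_min wz; have [m mP] := weak_meet_exists hS Ww Wt.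
  have [Wm _ mt _] := mP; apply: weak_le_trans mt; apply: w_min => //.
  exact: cambrian_meet (cambrian_refl Ww) zt (meet_le Ww wz) mP.
by apply: z_min; rewrite ?below.
Qed.

(** The kernel of the projection to [<<[set s]>>] contains the generating pairs, because no pair
    with [2 < #[r * t]] lies in [[set s]]. So an element congruent to [s] projects to [s] and lies
    above it. *)
Lemma camb_gens s : s \in S -> Camb s.
Proof.
move=> Ss; have Ws := mem_gen Ss; split=> // y Wy sy.
have sKS: [set s] \subset S by rewrite sub1set.
have hK := coherent_sub sKS hS.
have gens r t : precedes S c r t ->
    parabolic_hom S [set s] t == parabolic_hom S [set s] (alt #[r * t].-1 t r).
  case=> Sr St rt2 _; rewrite parabolic_hom_alt // !inE.
  apply/negP=> /andP[/eqP eq_r /eqP eq_t]; move: rt2.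
  by rewrite eq_r eq_t (gens_invol hS Ss) order1.
have /eqP := sy _ (pullback_congruence hS sKS (eq_congruence hK)) gens.
rewrite (parabolic_hom_id hS sKS (mem_gen (set11 s))) => ->.
exact: parabolic_hom_le.
Qed.

Lemma camb_minimum b : is_minimum le Camb b <-> b = 1.
Proof.
split=> [[[Wb _] b_min] | ->]; last by split=> [|x [Wx _]]; [apply: camb1 | apply: weak_le1].
apply: (weak_le_anti hS Wb); [exact: b_min camb1 | exact: weak_le1].
Qed.

Lemma weak_le_gens s x : s \in S -> x \in W -> le s x = (s \in N x).
Proof.
move=> Ss Wx; have Ws := mem_gen Ss.
by rewrite weak_leE // Wx (inversion_set_gen hS Ss) sub1set.
Qed.

Lemma descent_exists x : x \in W -> x != 1 -> exists2 s, s \in S & le s x.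
Proof.
move=> Wx x1; have [[|s u] red_u] := reduced_word_exists Wx.
  by case: red_u x1; rewrite word_prod_nil => _ <-; rewrite eqxx.
have [Ss _ _] := reduced_cons red_u; exists s => //.
rewrite weak_le_gens //; exact: (reduced_head_inversion hS red_u).
Qed.

Lemma below_gen s x : s \in S -> x \in W -> le x s -> x = 1 \/ x = s.
Proof.
move=> Ss Wx xs; have [-> | x1] := eqVneq x 1; first by left.
right; have [t St tx] := descent_exists Wx x1.
have := weak_le_trans tx xs; rewrite (weak_le_gens St (mem_gen Ss)).
rewrite (inversion_set_gen hS Ss) in_set1 => /eqP eq_t; rewrite eq_t in tx.
exact: (weak_le_anti hS Wx xs tx).
Qed.

Lemma gens_neq1 s : s \in S -> s != 1.
Proof. by move=> Ss; rewrite -order_eq1 hS.1. Qed.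

Lemma camb_atom a : is_atom le Camb a <-> a \in S.
Proof.
split=> [[b /camb_minimum-> [_ [Wa a_min] _ /eqP a1 a_cov]] | Sa].
  have [s Ss sa]: exists2 s, s \in S & le s a.
    by apply: descent_exists; rewrite // eq_sym.
  have [s1|<- //] := a_cov s (camb_gens Ss) (weak_le1 hS (mem_gen Ss)) sa.
  by have := gens_neq1 Ss; rewrite s1 eqxx.
exists 1; first exact/camb_minimum.
split; [exact: camb1|exact: camb_gens|by apply: weak_le1; rewrite ?mem_gen| |].
  by apply/eqP; rewrite eq_sym gens_neq1.
by move=> z [Wz _] _ za; apply: below_gen.
Qed.

Lemma camb_is_join x y z : Camb x -> Camb y -> joinW x y z -> is_join le Camb x y z.
Proof.
move=> Cx Cy jz; have Cz := camb_join Cx Cy jz; case: jz => Wz xz yz z_min.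
by split=> // t [Wt _]; apply: z_min.
Qed.

(** Joins the letters one at a time; [P] carries along any property stable under these joins, such
    as an upper bound for the join or for its image under a homomorphism. *)
Lemma camb_join_list (l : seq gT) : {subset l <= S} ->
  forall P : gT -> Prop, P 1 ->
    (forall x s z, Camb x -> s \in l -> P x -> joinW x s z -> P z) ->
  exists x, [/\ Camb x, P x & forall s, s \in l -> le s x].
Proof.
elim: l => [|s l IHl] Sl P P1 Pjoin; first by exists 1; split=> //; apply: camb1.
have [Ss Sl'] := (subset_consP S s l).1 Sl.
have [|x [Cx Px x_ub]] := IHl Sl' P P1.
  by move=> x t z Cx tl; apply: Pjoin; rewrite // inE tl orbT.
have [z jz] := weak_join_exists hS (camb_gen Cx) (mem_gen Ss).
exists z; split; first exact: camb_join Cx (camb_gens Ss) jz.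
  by apply: Pjoin jz => //; rewrite inE eqxx.
have [_ xz sz _] := jz.
by move=> t; rewrite inE => /predU1P[-> // | /x_ub tx]; apply: weak_le_trans tx xz.
Qed.

Lemma upper_bound_gens x : x \in W -> (forall s, s \in S -> le s x) -> x = longest S.
Proof.
move=> Wx ub; apply: inversions_gens_longest => //; apply/subsetP=> s Ss.
by rewrite -weak_le_gens ?ub.
Qed.

Lemma camb_longest (P : gT -> Prop) : P 1 ->
  (forall x s z, Camb x -> s \in S -> P x -> is_join le Camb x s z -> P z) ->
  Camb (longest S) /\ P (longest S).
Proof.
move=> P1 Pjoin; have [x|x s z Cx|x [Cx Px ub]] := @camb_join_list (enum S) _ P P1.
- by rewrite mem_enum.
- rewrite mem_enum => Ss Px jz; apply: Pjoin Px (camb_is_join Cx (camb_gens Ss) jz) => //.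
rewrite -(upper_bound_gens (camb_gen Cx)) // => s Ss.
by apply: ub; rewrite mem_enum.
Qed.

Lemma camb_longest_mem : Camb (longest S).
Proof. by case: (@camb_longest (fun=> True)). Qed.

End Camb.

End Cambrian.

(** * Comparison of the Cambrian lattices of [W] and of a parabolic subgroup *)

Section CambrianParabolic.

Variables (gT : finGroupType) (S J : {set gT}) (c ct : gT).
Hypothesis (hS : inversions_coherent S) (sJS : J \subset S).
Hypothesis hct : forall r s,
  precedes J ct r s <-> [/\ precedes S c r s, r \in J & s \in J].
Implicit Types x y z s t : gT.

Local Notation W := <<S>>.
Local Notation WJ := <<J>>.
Local Notation N := (inversion_set S).
Local Notation T := (reflections S).
Local Notation TJ := (reflections J).
Local Notation hJ := (coherent_sub sJS hS).
Local Notation eta := (parabolic_hom S J).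
Local Notation Camb := (camb W S c).
Local Notation CambJ := (camb WJ J ct).

(** The pullback of a congruence [R] along [eta] contains every generating pair: pairs inside [J]
    are generating for [ct], and [parabolic_hom_alt] collapses the others. *)
Lemma cambrian_eta x y : x \in W -> y \in W ->
  cambrian_congruence W S c x y -> cambrian_congruence WJ J ct (eta x) (eta y).
Proof.
move=> Wx Wy xy R cR gR.
apply: (xy _ (pullback_congruence hS sJS cR)) => r s /[dup] prec_rs [Sr Ss rs2 _].
have [/andP[Jr Js] | notJ] := boolP ((r \in J) && (s \in J)); last first.
  rewrite /= parabolic_hom_alt //; case: cR => R_refl _ _ _ _.
  exact/R_refl/parabolic_hom_gen/mem_gen.
have sK: [set s; r] \subset J by rewrite subUset !sub1set Js.
have Jalt: alt #[r * s].-1 s r \in WJ by apply: subsetP (genS sK) _ (alt_gen _ _ _).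
rewrite /= (parabolic_hom_id hS sJS (mem_gen Js)) (parabolic_hom_id hS sJS Jalt).
by apply/gR/hct.
Qed.

Lemma cambrian_parabolic x y :
  cambrian_congruence WJ J ct x y -> cambrian_congruence W S c x y.
Proof.
move=> xy R cR gR; apply: (xy R (restrict_congruence hS sJS cR)) => r s /hct[prec _ _].
exact: gR.
Qed.

(** If [y] is congruent to [x], then [eta y] is congruent to [eta x = x], so [x] lies below [eta y]
    and hence below [y]. *)
Lemma camb_parabolic x : CambJ x -> Camb x.
Proof.
case=> Jx x_min; have Wx := parabolic_gen sJS Jx; split=> // y Wy /(cambrian_eta Wx Wy).
rewrite (parabolic_hom_id hS sJS Jx) => /(x_min _ (parabolic_hom_gen hS sJS Wy)).
rewrite (weak_le_parabolic hS sJS) ?parabolic_hom_gen // => xy.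
exact: (weak_le_trans xy (parabolic_hom_le hS sJS Wy)).
Qed.

(* If [y] in [<<J>>] is congruent to [eta x], then joining with [fibre_top] and
   meeting with [x] shows that [x] lies below [y v fibre_top]; apply [eta]. *)
Lemma camb_eta x : Camb x -> CambJ (eta x).
Proof.
case=> Wx x_min; have Jx := parabolic_hom_gen hS sJS Wx.
split=> // y Jy /cambrian_parabolic xy.
have Wy := parabolic_gen sJS Jy; have Wex := parabolic_gen sJS Jx.
rewrite (weak_le_parabolic hS sJS) //; pose p := fibre_top S J.
have [Wp Np] : p \in W /\ N p = T :\: TJ.
  have [] := fibre_topP hS sJS (group1 <<J>>).
  by rewrite mul1g (inversion_set1 hS) set0U.
have [Wxp Nxp] := fibre_topP hS sJS Jx; have [Wyp Nyp] := fibre_topP hS sJS Jy.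
have [j jP] := weak_join_exists hS Wex Wp; have [k kP] := weak_join_exists hS Wy Wp.
have [[Wj xj pj _] [Wk yk pk k_min]] := (jP, kP).
(* The inversions of [j] include those of [eta x] and of [p], hence those of the top of the fibre
   that contains [x]. *)
have xj': weak_le S x j.
  apply: weak_le_trans (eta_adjoint hS sJS Wx Jx (weak_le_refl _ _)) _.
  move: xj pj; rewrite !(weak_leE hS) // => /andP[_ xj] /andP[_ pj].
  by rewrite Wj Nxp subUset xj -Np.
have jk: cambrian_congruence W S c j k.
  exact: (cambrian_join Wex Wy Wp Wp xy (cambrian_refl Wp) jP kP).
have [m mP] := weak_meet_exists hS Wx Wk.
have xm: weak_le S x m.
  have [Wm _ _ _] := mP; apply: x_min => //.
  exact: (cambrian_meet Wx Wx Wj Wk (cambrian_refl Wx) jk (meet_le Wx xj') mP).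
rewrite -(eta_fibre_top hS sJS Jy) parabolic_hom_mono //.
have [_ _ mk _] := mP; apply: weak_le_trans xm (weak_le_trans mk _).
by apply: k_min; rewrite // (weak_leE hS) // Wyp Nyp ?subsetUl // Np subsetUr.
Qed.

Lemma camb_parabolic_eta x : Camb x -> x \in WJ -> CambJ x.
Proof. by move=> /camb_eta + Jx; rewrite (parabolic_hom_id hS sJS Jx). Qed.

Lemma camb_parabolic_meet x y z : CambJ x -> CambJ y ->
  is_meet (weak_le J) CambJ x y z -> is_meet (weak_le S) Camb x y z.
Proof.
move=> [Jx _] [Jy _] [Cz zx zy z_max]; have [Jz _] := Cz.
rewrite !(weak_le_parabolic hS sJS) // in zx zy.
split=> //; first exact: camb_parabolic.
move=> t Ct tx ty; have Jt := parabolic_lower hS sJS (camb_gen Ct) Jx tx.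
rewrite -(weak_le_parabolic hS sJS) // z_max ?(weak_le_parabolic hS sJS) //.
exact: camb_parabolic_eta.
Qed.

Lemma camb_parabolic_join x y z : CambJ x -> CambJ y ->
  is_join (weak_le J) CambJ x y z -> is_join (weak_le S) Camb x y z.
Proof.
move=> [Jx _] [Jy _] [Cz xz yz z_min]; have [Jz _] := Cz.
rewrite !(weak_le_parabolic hS sJS) // in xz yz.
split=> //; first exact: camb_parabolic.
move=> t Ct xt yt; have Wt := camb_gen Ct; have Jt := parabolic_hom_gen hS sJS Wt.
apply: weak_le_trans (parabolic_hom_le hS sJS Wt).
have le_eta w : w \in WJ -> weak_le S w t -> weak_le J w (eta t).
  move=> Jw wt; rewrite (weak_le_parabolic hS sJS) // -(parabolic_hom_id hS sJS Jw).
  by rewrite parabolic_hom_mono ?(parabolic_gen sJS Jw).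
by rewrite -(weak_le_parabolic hS sJS) // z_min ?le_eta //; apply: camb_eta.
Qed.

Lemma camb_eta_meet x : Camb x -> is_meet (weak_le S) Camb x (longest J) (eta x).
Proof.
move=> Cx; have Wx := camb_gen Cx; have Jx := parabolic_hom_gen hS sJS Wx.
have J0 := longest_gen hJ; split; first exact/camb_parabolic/camb_eta.
- exact: parabolic_hom_le.
- by rewrite -(weak_le_parabolic hS sJS) //; apply: longest_max hJ _ Jx.
move=> t Ct tx tJ; have Wt := camb_gen Ct.
have Jt := parabolic_lower hS sJS Wt J0 tJ.
by rewrite -(parabolic_hom_id hS sJS Jt) parabolic_hom_mono.
Qed.

End CambrianParabolic.

(** * Surjective homomorphisms of Cambrian lattices and their action on atoms *)

Section CambrianMaps.

Variables (gT gT' : finGroupType) (S : {set gT}) (S' : {set gT'}).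
Variables (c : gT) (c' : gT') (f : gT -> gT').
Hypotheses (hS : inversions_coherent S) (hS' : inversions_coherent S').

Local Notation le := (weak_le S).
Local Notation le' := (weak_le S').
Local Notation Camb := (camb <<S>> S c).
Local Notation Camb' := (camb <<S'>> S' c').

Hypothesis f_hom : lattice_hom le Camb le' Camb' f.
Hypothesis f_surj : surjective_on Camb Camb' f.

Lemma camb_hom_gen x : Camb x -> f x \in <<S'>>.
Proof. by case: f_hom => f_in _ _ /f_in/camb_gen. Qed.

Lemma camb_hom_mono x y : Camb x -> Camb y -> le x y -> le' (f x) (f y).
Proof.
case: f_hom => _ f_meet _ Cx Cy xy; have [] // := f_meet x y x Cx Cy.
by split=> //; apply: weak_le_refl.
Qed.

Lemma camb_hom1 : f 1 = 1.
Proof.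
have [x Cx fx] := f_surj (camb1 hS' c'); have C1 := camb1 hS c.
apply: (weak_le_anti hS' (camb_hom_gen C1)); last exact/(weak_le1 hS')/camb_hom_gen.
by rewrite -[1 in X in le' _ X]fx camb_hom_mono // weak_le1 // (camb_gen Cx).
Qed.

Lemma camb_hom_longest u : Camb' u -> (forall s, s \in S -> le' (f s) u) ->
  le' (f (longest S)) u.
Proof.
move=> Cu gens_le; case: (f_hom) => _ _ f_join.
have [||//] := camb_longest hS (c := c) (P := fun x => le' (f x) u).
  by rewrite camb_hom1 weak_le1 // (camb_gen Cu).
move=> x s z Cx Ss fx jz; have [_ _ _] := f_join _ _ _ Cx (camb_gens hS c Ss) jz.
by apply=> //; apply: gens_le.
Qed.

Lemma camb_hom_bijective_on_atoms : (forall s, s \in S -> f s != 1) ->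
  bijective_on_atoms le Camb le' Camb' f.
Proof.
move=> f_neq1; case: (f_hom) => f_in f_meet _.
have C1 := camb1 hS c; have C1' := camb1 hS' c'.
have meet_gens s x : s \in S -> Camb x ->
    is_meet le Camb s x 1 \/ is_meet le Camb s x s.
  move=> Ss Cx; have Wx := camb_gen Cx; have Ws := mem_gen Ss.
  case sx: (le s x); [right | left].
    by split=> //; [apply: camb_gens | apply: weak_le_refl].
  split; rewrite ?weak_le1 // => t Ct ts tx.
  have [->|eq_t] := below_gen hS Ss (camb_gen Ct) ts; first exact: weak_le_refl.
  by rewrite -eq_t tx in sx.
(* Choose an atom [t] below [f s] and a preimage [x] of [t]. If [s] and [x] met in 1, then [t] would
   lie below [f 1 = 1]; so they meet in [s], and [f s] lies below [t]. *)
have gens_gens s : s \in S -> f s \in S'.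
  move=> Ss; have Cs := camb_gens hS c Ss.
  have [t St ts] := descent_exists hS' (camb_hom_gen Cs) (f_neq1 s Ss).
  have Ct := camb_gens hS' c' St; have [x Cx fx] := f_surj Ct.
  have [m1|ms] := meet_gens s x Ss Cx.
    have [_ _ _ max1] := f_meet _ _ _ Cs Cx m1.
    have := max1 t Ct ts; rewrite fx weak_le_refl camb_hom1 => /(_ isT) t1.
    have := gens_neq1 hS' St.
    by rewrite (weak_le_anti hS' (mem_gen St) t1) ?eqxx // weak_le1 ?mem_gen.
  have [_ _ le_t _] := f_meet _ _ _ Cs Cx ms; rewrite fx in le_t.
  by rewrite (weak_le_anti hS' (camb_hom_gen Cs) le_t ts).
split=> [a /(camb_atom hS c)Sa | a b /(camb_atom hS c)Sa /(camb_atom hS c)Sb eq_ab |].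
- by apply/(camb_atom hS' c')/gens_gens.
- have [Ca Cb] := (camb_gens hS c Sa, camb_gens hS c Sb).
  have [m1|ma] := meet_gens a b Sa Cb.
    have [_ _ _ max1] := f_meet _ _ _ Ca Cb m1.
    have := max1 (f a) (f_in a Ca) (weak_le_refl _ _).
    rewrite -eq_ab weak_le_refl camb_hom1 => /(_ isT) a1.
    have := f_neq1 a Sa; rewrite (weak_le_anti hS' (camb_hom_gen Ca) a1) ?eqxx //.
    by rewrite weak_le1 // camb_hom_gen.
  have [_ _ ab _] := ma.
  have [a1|//] := below_gen hS Sb (mem_gen Sa) ab.
  by have := gens_neq1 hS Sa; rewrite a1 eqxx.
move=> t /(camb_atom hS' c')St; have [/existsP[s /andP[Ss /eqP <-]]|no_s] :=
    boolP [exists s, (s \in S) && (f s == t)].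
  by exists s => //; apply/(camb_atom hS c).
(* If [t] is missed, all atoms map into [K], so [f (longest S)] lies below an element of [<<K>>]. It
   also lies above [t] by surjectivity, which would put [t] in [<<K>>]. *)
pose K := S' :\ t; have sKS: K \subset S' by apply: subsetDl.
have gens_K s : s \in S -> f s \in K.
  move=> Ss; rewrite !inE gens_gens // andbT.
  by apply: contra no_s => fs; apply/existsP; exists s; rewrite Ss.
have [WK NK] := longestP (coherent_sub sKS hS'); have W'K := parabolic_gen sKS WK.
(* [x] is an upper bound of [K] inside [Camb']; keeping it below [longest K] keeps it in [<<K>>]. *)
have [s| |x s z Cx|x [Cx xK x_ub]] :=
    @camb_join_list _ _ hS' c' (enum K) _ (fun x => le' x (longest K)).
- by rewrite mem_enum => /(subsetP sKS).
- exact: weak_le1.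
- rewrite mem_enum => Ks xK [_ _ _ z_min]; apply: z_min => //.
  rewrite -(weak_le_parabolic hS' sKS (mem_gen Ks) WK).
  by apply: longest_max; [apply: coherent_sub hS' | apply: mem_gen].
have CS := camb_longest_mem hS c.
have [y Cy fy] := f_surj (camb_gens hS' c' St).
have tx: le' t x.
  apply: (weak_le_trans (_ : le' t (f (longest S)))).
    by rewrite -fy camb_hom_mono // longest_max // (camb_gen Cy).
  apply: camb_hom_longest => // s Ss; apply: x_ub; rewrite mem_enum; exact: gens_K.
have Kx := parabolic_lower hS' sKS (camb_gen Cx) WK xK.
have := parabolic_lower hS' sKS (mem_gen St) Kx tx.
by rewrite (parabolic_gens hS' sKS) // !inE eqxx.
Qed.

End CambrianMaps.

(** * Factorization of a surjective homomorphism through the parabolic projection *)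

Theorem theorem8p8 (gT gT' : finGroupType)
  (W : {group gT}) (S : {set gT}) (W' : {group gT'}) (S' : {set gT'})
  (c : gT) (c' : gT') (eta : gT -> gT')
  (hW : coxeter_system W S) (hW' : coxeter_system W' S')
  (hc : coxeter_element S c) (hc' : coxeter_element S' c')
  (heta : lattice_hom (weak_le S) (camb W S c)
                      (weak_le S') (camb W' S' c') eta)
  (hsurj : surjective_on (camb W S c) (camb W' S' c') eta) :
  let J := [set s in S | eta s != 1] in
  forall ct : gT, coxeter_restriction S c J ct ->
  [/\ (forall x, camb W S c x -> camb <<J>> J ct (parabolic_hom S J x)),
      (forall x, camb <<J>> J ct x -> camb W S c x),
      (forall x, camb W S c x -> eta x = eta (parabolic_hom S J x)) &
      compressive (weak_le J) (camb <<J>> J ct)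
                  (weak_le S') (camb W' S' c') eta].
Proof.
move=> J ct hct; have hS := coxeter_system_coherent hW.
have hS' := coxeter_system_coherent hW'.
have [eqW _ _] := hW; have [eqW' _ _] := hW'.
rewrite -eqW -eqW' in heta hsurj *.
have sJS: J \subset S by apply/subsetP=> s; rewrite inE => /andP[].
have hJ := coherent_sub sJS hS.
have prec := restriction_precedes hS sJS hc hct.
have toJ := camb_eta hS sJS prec; have fromJ := camb_parabolic hS sJS prec.
have homJ: lattice_hom (weak_le J) (camb <<J>> J ct) (weak_le S') (camb <<S'>> S' c') eta.
  case: (heta) => eta_in eta_meet eta_join.
  split=> [x /fromJ/eta_in // | x y z Cx Cy m | x y z Cx Cy j].
    by apply: eta_meet; [exact: fromJ | exact: fromJ | apply: camb_parabolic_meet m].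
  by apply: eta_join; [exact: fromJ | exact: fromJ | apply: camb_parabolic_join j].
have eta_factor x : camb <<S>> S c x -> eta x = eta (parabolic_hom S J x).
  move=> Cx; have Cex := fromJ _ (toJ _ Cx).
  have C0J := camb_longest_mem hJ ct.
  have C0 := camb_longest_mem hS c.
  have C0S := fromJ _ C0J; have mono := camb_hom_mono heta.
  have eta0 : weak_le S' (eta (longest S)) (eta (longest J)).
    apply: (camb_hom_longest hS hS' heta hsurj); first by case: heta => + _ _; apply.
    move=> s Ss; have Cs := camb_gens hS c Ss.
    case Js: (s \in J).
      apply: mono => //; have WJs := mem_gen Js.
      by rewrite -(weak_le_parabolic hS sJS) ?longest_max ?longest_gen.
    move: Js; rewrite inE Ss /= => /negbFE/eqP->.
    by rewrite weak_le1 // (camb_hom_gen heta).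
  apply: (weak_le_anti hS'); first exact: (camb_hom_gen heta).
    (* The image of [parabolic_hom S J x] is the meet of [eta x] and [eta (longest J)], and by
       [eta0] the latter lies above [eta (longest S)], hence above [eta x]. *)
    case: (heta) => eta_in eta_meet _.
    have [_ _ _] := eta_meet _ _ _ Cx C0S (camb_eta_meet hS sJS prec Cx).
    apply; rewrite ?weak_le_refl //; first exact: eta_in.
    apply: weak_le_trans eta0; apply: mono => //.
    by apply: longest_max => //; apply: camb_gen Cx.
  by apply: mono => //; apply: parabolic_hom_le => //; apply: camb_gen Cx.
have surjJ: surjective_on (camb <<J>> J ct) (camb <<S'>> S' c') eta.
  by move=> y /hsurj[x Cx <-]; exists (parabolic_hom S J x); [apply: toJ | rewrite -eta_factor].
split=> //; split=> //.
apply: camb_hom_bijective_on_atoms => // s; by rewrite inE => /andP[].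
Qed.
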